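(* Assume that hypotheses (C1)–(C5) and (C6)* of the context hold and that there exists a bounded solution of the compartmental system (S) of the context. Let $K_1=\{(\omega,x(\omega)):\omega\in\Omega\}$ and $K_2=\{(\omega,y(\omega)):\omega\in\Omega\}$ be two minimal subsets of $\Omega\times BU_D^+$. Let $J_1,\dots,J_k$ be all the irreducible subsets of $I=\{1,\dots,m\}$ and $J_0=I\setminus\bigcup_{l=1}^kJ_l$. Then (i) $x_i\equiv y_i$ for each $i\in J_0$. (ii) If, for some $l\in\{1,\dots,k\}$, there is a $j_l\in J_l$ such that there is outflow of material from $C_{j_l}$, then $x_i\equiv y_i$ for each $i\in J_l$. (Here $x_i\equiv y_i$ means that the $i$-th components of $x(\omega)$ and $y(\omega)$ coincide on $(-\infty,0]$ for every $\omega\in\Omega$.)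
   Context: Notation. $X=C((-\infty,0],\mathbb{R}^m)$ carries the compact-open topology. $BU\subset X$ is the Banach space of bounded uniformly continuous functions with the supremum norm $\|x\|_\infty$; $B_r=\{x\in BU:\|x\|_\infty\le r\}$. For continuous $x$ on $(-\infty,a]$ and $t\le a$, $x_t(s)=x(t+s)$, $s\le0$. $\mathbb{R}^+=[0,\infty)$. Compartmental system (compartments $C_1,\dots,C_m$, environment $C_0$, pipe $P_{ij}$ from $C_j$ to $C_i$). For $i\in\{0,\dots,m\}$, $j\in\{1,\dots,m\}$ let $\tilde g_{ij}\colon\mathbb{R}\times\mathbb{R}\to\mathbb{R}$, and for $i\in\{1,\dots,m\}$ let $\tilde I_i\colon\mathbb{R}\to[0,\infty)$; put $\tilde g_{i0}(t,v)=\tilde I_i(t)$ and $\tilde g=(\tilde g_{ij})\colon\mathbb{R}\times\mathbb{R}\to\mathbb{R}^{m(m+2)}$. For $i,j\in\{1,\dots,m\}$ let $\mu_{ij},\nu_{ij}$ be positive regular Borel measures on $(-\infty,0]$ with finite total variation. The system (S) is, for $i=1,\dots,m$, $t\ge0$, $$\tfrac{d}{dt}\Big[z_i(t)-\sum_{j=1}^m\int_{-\infty}^0z_j(t+s)\,d\nu_{ij}(s)\Big]=-\tilde g_{0i}(t,z_i(t))-\sum_{j=1}^m\tilde g_{ji}(t,z_i(t))+\sum_{j=1}^m\int_{-\infty}^0\tilde g_{ij}(t+s,z_j(t+s))\,d\mu_{ij}(s)+\tilde I_i(t),$$ with initial data in $BU$; a solution is bounded if it is bounded on $[0,\infty)$.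 Hypotheses: (C1) $\tilde g$ is $C^1$-admissible, i.e. $C^1$ in its second variable, with $\tilde g$ and $\frac{\partial\tilde g}{\partial v}$ uniformly continuous and bounded on $\mathbb{R}\times\{v_0\}$ for all $v_0\in\mathbb{R}$; all components are monotone (nondecreasing) in the second variable; and $\tilde g_{ij}(t,0)=0$ for all $t\in\mathbb{R}$, $i\in\{0,\dots,m\}$, $j\in\{1,\dots,m\}$. (C2) $\tilde g$ is recurrent, i.e. its hull is minimal. (C3) $\mu_{ij}(-\infty,0]=1$ and $\int_{-\infty}^0|s|\,d\mu_{ij}(s)<\infty$. (C4) $\nu_{ij}(\{0\})=0$ and $\sum_{j=1}^m\nu_{ij}(-\infty,0]<1$ for each $i$. Define $D\colon BU\to\mathbb{R}^m$ by $D_ix=x_i(0)-\sum_{j=1}^m\int_{-\infty}^0x_j(s)\,d\nu_{ij}(s)$. (C5) The measures $d\eta_{ij}=c_{ij}\,d\mu_{ij}-\sum_{k=0}^md_{ki}\,d\nu_{ij}$ ($1\le i,j\le m$) are positive, where $c_{ij}=\inf_{(t,v)\in\mathbb{R}^2}\frac{\partial\tilde g_{ij}}{\partial v}(t,v)$, $d_{ij}=\sup_{(t,v)\in\mathbb{R}^2}\frac{\partial\tilde g_{ij}}{\partial v}(t,v)$. (C6)* Given $i\in\{0,\dots,m\}$ and $j\in\{1,\dots,m\}$, either $\tilde g_{ij}\equiv0$ on $\mathbb{R}\times\mathbb{R}^+$ (there is no pipe from $C_j$ to $C_i$), or for each $v\ge0$ there is a $\delta_v>0$ such that $\frac{\partial\tilde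 g_{ij}}{\partial v}(t,v)\ge\delta_v$ for each $t\in\mathbb{R}$; in the latter case the pipe $P_{ij}$ is said to carry material. There is outflow of material from $C_j$ if $P_{0j}$ carries material. Irreducible sets. For $J\subset I$ let $\zeta(J)=\bigcup_{j\in J}\{i\in I:P_{ij}\text{ carries material}\}$. A nonempty $J\subset I$ is irreducible if $\zeta(J)\subset J$ and no nonempty proper subset of $J$ has that property. Family over the hull. $\Omega$ is the hull of $\tilde g$: the closure of $\{\tilde g_t:t\in\mathbb{R}\}$, $\tilde g_t(s,v)=\tilde g(t+s,v)$, in the topology of uniform convergence on compact sets; it is a compact metric space with the translation flow $(\omega\cdot t)(s,v)=\omega(t+s,v)$, minimal by (C2). Put $g(\omega,v)=\omega(0,v)$, $g=(g_{ij})$, $I_i(\omega)=g_{i0}(\omega,\cdot)$, and $F_i(\omega,x)=-g_{0i}(\omega,x_i(0))-\sum_{j=1}^mg_{ji}(\omega,x_i(0))+\sum_{j=1}^m\int_{-\infty}^0g_{ij}(\omega\cdot s,x_j(s))\,d\mu_{ij}(s)+I_i(\omega)$ for $(\omega,x)\in\Omega\times BU$. The family is $\frac{d}{dt}Dz_t=F(\omega\cdot t,z_t)$, $t\ge0$, $\omega\in\Omega$; $z(t,\omega,x)$ is the unique solution with initial value $x\in BU$, $u(t,\omega,x)(s)=z(t+s,\omega,x)$, and $\tau(t,\omega,x)=(\omega\cdot t,u(t,\omega,x))$ is the induced skew-product semiflow. It is part of the setting that $F$ is continuous and locally Lipschitz in $x$ for $\|\cdot\|_\infty$, bounded on each $\Omega\times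 B_r$, and continuous on each $\Omega\times B_r$ for the compact-open topology on $B_r$. A minimal subset is a nonempty compact (for the product metric topology, compact-open on $BU$) positively $\tau$-invariant set containing no other nonempty compact positively invariant set; every such set is of the form $\{(\omega,x(\omega)):\omega\in\Omega\}$ with $x\colon\Omega\to BU$ continuous for the compact-open topology and $x(\omega\cdot t)=u(t,\omega,x(\omega))$. $BU_D^+=\{x\in BU:Dx_s\ge0\text{ for each }s\le0\}$. *)

(* Defs.v *)
From HB Require Import structures.
From mathcomp Require Import all_boot all_order all_algebra.
From mathcomp Require Import all_classical all_reals all_analysis.
Import Order.TTheory GRing.Theory Num.Theory.
Import numFieldNormedType.Exports.

Set Implicit Arguments.
Unset Strict Implicit.
Unset Printing Implicit Defensive.

Local Open Scope classical_set_scope.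
Local Open Scope ring_scope.

Definition past (R : realType) := set_type (`]-oo, 0]%classic : set R).

Lemma past0_subproof (R : realType) : (0 : R) \in (`]-oo, 0]%classic : set R).
Proof. by rewrite inE /= in_itv /=. Qed.

Definition past0 (R : realType) : past R := exist _ 0 (past0_subproof R).

HB.instance Definition _ (R : realType) := PseudoMetric.on (past R).
HB.instance Definition _ (R : realType) := isPointed.Build (past R) (past0 R).

Lemma past_add_subproof (R : realType) (s r : past R) :
  set_val s + set_val r \in (`]-oo, 0]%classic : set R).
Proof.
have := set_valP s; have := set_valP r.
rewrite inE /= !in_itv /= => r0 s0; rewrite -[leRHS]addr0; exact: lerD.
Qed.

Definition past_add (R : realType) (s r : past R) : past R :=
  exist _ (set_val s + set_val r) (past_add_subproof s r).

(* Finite Borel measures on (-oo, 0]; regularity is automatic since the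
   half-line is a Polish space. *)
Notation pastMeasure R :=
  {finite_measure set (g_sigma_algebraType (@open (past R))) -> \bar R}.

Section HalfLine.
Context {R : realType} {m : nat}.

(* Row i of the first component stands for the pipes ending in compartment i,
   row [ord0] being the environment and row [lift ord0 i] the compartment
   i : 'I_m; column j stands for the pipes starting in compartment j.  The
   second component is the vector of the inflows from the environment. *)
Definition rates := ('M[R]_(m.+1, m) * 'rV[R]_m)%type.

Definition cmpt (i : 'I_m) : 'I_m.+1 := lift ord0 i.

Implicit Types (x y : past R -> 'rV[R]_m) (z : R -> 'rV[R]_m).

Definition supnorm x : R := sup (range (fun s => `|x s|)).

Definition BU : set (past R -> 'rV[R]_m) :=
  [set x | bounded_fun x /\ unif_continuous x].

Definition BUball (r : R) : set (past R -> 'rV[R]_m) :=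
  BU `&` [set x | supnorm x <= r].

Definition history z (t : R) : past R -> 'rV[R]_m := fun s => z (t + set_val s).

Definition past_shift x (s : past R) : past R -> 'rV[R]_m :=
  fun r => x (past_add s r).

(* f has derivative l at t as a function on [0, +oo), so one-sided at 0. *)
Definition deriv_on_nneg (f : R -> R) (t l : R) : Prop :=
  (fun h => h^-1 * (f (t + h) - f t)) @ within [set h | 0 <= t + h] 0^' --> l.

Definition ratefun := {family compact, R * R -> rates}.

Definition translate (w : ratefun) (t : R) : ratefun :=
  fun p => w (t + p.1, p.2).

Definition hull (w : ratefun) : set ratefun := closure (range (translate w)).

Definition translation_invariant (M : set ratefun) : Prop :=
  forall w t, M w -> M (translate w t).

Definition flow_minimal (M : set ratefun) : Prop :=
  [/\ M !=set0, compact M, translation_invariant M &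
      forall N : set ratefun, N !=set0 -> closed N -> translation_invariant N ->
        N `<=` M -> N = M].

Definition recurrent (w : ratefun) : Prop := flow_minimal (hull w).

Definition dv (f : R -> R -> R) (t v : R) : R := derive1 (f t) v.

Definition C1_admissible (f : R -> R -> R) : Prop :=
  [/\ forall t v, derivable (f t) v 1,
      forall t, continuous (dv f t),
      forall v, unif_continuous (f ^~ v) /\ bounded_fun (f ^~ v) &
      forall v, unif_continuous (dv f ^~ v) /\ bounded_fun (dv f ^~ v)].

Section Transport.
Variables (g : 'I_m.+1 -> 'I_m -> R -> R -> R) (inflow : 'I_m -> R -> R).

Definition bundle : ratefun :=
  fun p => (\matrix_(i, j) g i j p.1 p.2, \row_i inflow i p.1).

Definition transport_hyp : Prop :=
  [/\ forall i j, C1_admissible (g i j),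
      forall i, C1_admissible (fun t _ => inflow i t),
      forall i j t, nondecreasing_fun (g i j t),
      forall i j t, g i j t 0 = 0 &
      forall i t, 0 <= inflow i t].

(* Extended reals, so that an unbounded derivative is not given the junk
   value of the real [sup]. *)
Definition dv_inf i j : \bar R :=
  ereal_inf (range (fun p : R * R => (dv (g i j) p.1 p.2)%:E)).

Definition dv_sup i j : \bar R :=
  ereal_sup (range (fun p : R * R => (dv (g i j) p.1 p.2)%:E)).

Definition carries_material (i : 'I_m.+1) (j : 'I_m) : Prop :=
  forall v, 0 <= v -> exists2 delta, 0 < delta &
    forall t, delta <= dv (g i j) t v.

Definition pipe_hyp : Prop :=
  forall i j, (forall t v, 0 <= v -> g i j t v = 0) \/ carries_material i j.

Definition zeta (J : {set 'I_m}) : {set 'I_m} :=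
  \bigcup_(j in J) [set i | `[< carries_material (cmpt i) j >]]%SET.

Definition irreducible (J : {set 'I_m}) : Prop :=
  [/\ J != finset.set0, zeta J \subset J &
      forall J' : {set 'I_m}, J' != finset.set0 -> J' \proper J ->
        ~~ (zeta J' \subset J')].

Definition transient : {set 'I_m} :=
  (~: \bigcup_(J | `[< irreducible J >]) J)%SET.

End Transport.

Section Equation.
Variables (mu nu : 'I_m -> 'I_m -> pastMeasure R).

Definition transit_hyp : Prop :=
  forall i j, mu i j setT = 1%E /\
    (\int[mu i j]_s `|set_val (s : past R)|%:E < +oo)%E.

Definition neutral_hyp : Prop :=
  (forall i j, nu i j [set past0 R] = 0%E) /\
  (forall i, (\sum_j nu i j setT < 1)%E).

(* [mu i j] and [nu i j] are finite, so c_ij dmu_ij - \sum_k d_ki dnu_ij is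
   well defined as an extended real; since 0 * +oo = 0, an infinite d_ki is
   harmless exactly on the sets that are null for [nu i j]. *)
Definition eta_hyp (g : 'I_m.+1 -> 'I_m -> R -> R -> R) : Prop :=
  forall i j A, measurable A ->
    (0 <= dv_inf g (cmpt i) j * mu i j A
          - \sum_(k < m.+1) dv_sup g k i * nu i j A)%E.

Definition D (x : past R -> 'rV[R]_m) : 'rV[R]_m :=
  \row_i (x (past0 R) 0 i - \sum_j \int[nu i j]_s x s 0 j).

Definition BUDpos : set (past R -> 'rV[R]_m) :=
  BU `&` [set x | forall s i, 0 <= D (past_shift x s) 0 i].

Definition system_solution (g : 'I_m.+1 -> 'I_m -> R -> R -> R)
    (inflow : 'I_m -> R -> R) (z : R -> 'rV[R]_m) : Prop :=
  [/\ continuous z, BU (history z 0) &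
      forall t i, 0 <= t ->
        deriv_on_nneg
          (fun u => z u 0 i - \sum_j \int[nu i j]_s z (u + set_val s) 0 j) t
          (- g ord0 i t (z t 0 i) - \sum_j g (cmpt j) i t (z t 0 i)
           + \sum_j \int[mu i j]_s
               g (cmpt i) j (t + set_val s) (z (t + set_val s) 0 j)
           + inflow i t)].

Definition bounded_solution g inflow (z : R -> 'rV[R]_m) : Prop :=
  system_solution g inflow z /\ exists M, forall t, 0 <= t -> `|z t| <= M.

Definition pipe (i : 'I_m.+1) (j : 'I_m) (w : ratefun) (v : R) : R :=
  (w (0, v)).1 i j.

(* The inflow components of the elements of the hull do not depend on v. *)
Definition env_inflow (i : 'I_m) (w : ratefun) : R := (w (0, 0)).2 0 i.

Definition F (w : ratefun) (x : past R -> 'rV[R]_m) : 'rV[R]_m :=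
  \row_i (- pipe ord0 i w (x (past0 R) 0 i)
          - \sum_j pipe (cmpt j) i w (x (past0 R) 0 i)
          + \sum_j \int[mu i j]_s
              pipe (cmpt i) j (translate w (set_val s)) (x s 0 j)
          + env_inflow i w).

Definition phase : Type := (ratefun * {compact-open, past R -> 'rV[R]_m})%type.

Definition phase_unif : Type := (ratefun * {uniform past R -> 'rV[R]_m})%type.

Definition F_regular (Omega : set ratefun) : Prop :=
  [/\ {within (Omega `*` BU : set phase_unif),
        continuous (fun p : phase_unif => F p.1 p.2)},
      forall w0 x0, Omega w0 -> BU x0 ->
        exists U : set ratefun, exists r L : R,
          [/\ nbhs w0 U, 0 < r & forall w x y, (Omega `&` U) w -> BU x -> BU y ->
            supnorm (x - x0) <= r -> supnorm (y - x0) <= r ->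
            `|F w x - F w y| <= L * supnorm (x - y)],
      forall r : R, exists M : R, forall w x, Omega w -> BUball r x ->
        `|F w x| <= M &
      forall r : R, {within (Omega `*` BUball r : set phase),
        continuous (fun p : phase => F p.1 p.2)}].

Definition family_solution (w : ratefun) (x : past R -> 'rV[R]_m)
    (z : R -> 'rV[R]_m) : Prop :=
  [/\ continuous z, history z 0 = x &
      forall t i, 0 <= t ->
        deriv_on_nneg (fun u => D (history z u) 0 i) t
          (F (translate w t) (history z t) 0 i)].

(* The solution z(., w, x) being unique, the semiflow is used through its
   orbits t |-> (translate w t, history z t). *)
Definition positively_invariant (K : set phase) : Prop :=
  forall w x, K (w, x) -> exists2 z, family_solution w x z &
    forall t, 0 <= t -> K (translate w t, history z t).

Definition minimal_subset (Omega : set ratefun) (K : set phase) : Prop :=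
  [/\ K `<=` Omega `*` BU, K !=set0, compact K, positively_invariant K &
      forall L : set phase, L !=set0 -> compact L -> positively_invariant L ->
        L `<=` K -> L = K].

Definition graph_over (Omega : set ratefun)
    (x : ratefun -> past R -> 'rV[R]_m) : set phase :=
  [set (w, x w) | w in Omega].

End Equation.
End HalfLine.

(* Main.v *)
(** Only the orbit of the base element of the hull matters.  Along it the two
    minimal sets give bounded, uniformly continuous, nonnegative solutions [X]
    and [Y] at all times [t <= 0].  Let [q i j = |g_ij(t, X_j) - g_ij(t, Y_j)|] be
    the mismatch of the flows in the pipe from [j] to [i], and [h = D X - D Y].
    Hypothesis (C5) makes the system quasimonotone, so that
      [d|h_i|/dt <= - sum_k q k i (t) + sum_j int q i j (t + s) dmu_ij(s)].
    Integrating over [-T, 0] and using that transit times have finite mean, the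
    integrated mismatches [N i j] form a nonnegative flow that is conserved at
    every compartment up to an error independent of [T].  Hence the mismatch in
    the pipes to the environment, and in the pipes entering a [zeta]-closed set
    from outside, stays bounded as [T] grows.  A bounded mismatch in a pipe
    that carries material forces [X_j - Y_j] to tend to [0] at [-oo], and
    minimality of the hull upgrades this to [x_j = y_j] everywhere.  Then all the
    mismatches leaving [j] vanish, so those entering [j] are bounded and the
    conclusion propagates upstream.  The compartments where it fails thus form
    a [zeta]-closed set, which irreducibility rules out. *)

Require Import Defs.
From mathcomp Require Import all_boot all_order all_algebra.
From mathcomp Require Import all_classical all_reals all_analysis.
From mathcomp Require Import measurable_realfun ring lra.
Import Order.TTheory GRing.Theory Num.Theory.
Import numFieldNormedType.Exports.

Set Implicit Arguments.
Unset Strict Implicit.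
Unset Printing Implicit Defensive.

Local Open Scope classical_set_scope.
Local Open Scope ring_scope.

(** * Functions on the past *)

Lemma past_le0 (R : realType) (s : past R) : set_val s <= 0.
Proof. by have := set_valP s; rewrite /= in_itv. Qed.

Lemma continuous_past_val (R : realType) :
  continuous (set_val : past R -> R).
Proof. exact: initial_continuous. Qed.

Lemma continuous_past_measurable (R : realType) (f : past R -> R) :
  continuous f ->
  measurable_fun [set: g_sigma_algebraType (@open (past R))] f.
Proof.
move=> cf; apply: (measurability _ (RGenOpens.measurableE R)).
move=> _ [B [a [b ->]] <-]; rewrite setTI.
by apply: sub_sigma_algebra; move/continuousP : cf; apply; exact: itv_open.
Qed.

Lemma integrable_past (R : realType) (mu : pastMeasure R) (f : past R -> R) (M : R) :
  continuous f -> (forall s, `|f s| <= M) -> mu.-integrable setT (EFin \o f).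
Proof.
move=> cf fM.
apply: (@measurable_bounded_integrable _ _ _ mu f setT) => //.
- exact/fin_num_fun_lty/fin_num_measure.
- exact: continuous_past_measurable.
- exists M; split=> [|K MK s _]; first exact: num_real.
  exact: le_trans (fM s) (ltW MK).
Qed.

Lemma continuous_itv_integrable (R : realType) (f : R -> R) (a b : R) :
  continuous f ->
  (@lebesgue_measure R).-integrable `[a, b] (EFin \o f).
Proof.
move=> cf; apply: continuous_compact_integrable; first exact: segment_compact.
exact: continuous_subspaceT.
Qed.

Lemma continuous_antiderivative (R : realType) (q : R -> R) :
  continuous q -> exists2 Q : R -> R, Q 0 = 0 &
    forall t, is_derive t (1 : R) Q (q t).
Proof.
move=> cq.
pose I a t : R := \int[@lebesgue_measure R]_(x in `[a, t]) q x.
have Iadd a b c : a <= b -> b <= c -> I a c = I a b + I b c.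
  move=> ab bc; apply/eqP; rewrite addrC -subr_eq /I Rintegral_itvB ?bnd_simp//.
    rewrite Rintegral_itv_obnd_cbnd//.
    refine (integrableS _ _ _ (continuous_itv_integrable b c cq)) => //.
    by apply: subset_itvr; rewrite bnd_simp.
  exact: continuous_itv_integrable.
pose Q t := if 0 <= t then I 0 t else - I t 0.
exists Q; first by rewrite /Q lexx /I set_itv1 Rintegral_set1.
(* [a] lies strictly left of both [t] and [0], so near [t] the two-case [Q] is a single integral
   from [a] minus a constant, and the fundamental theorem applies at an interior point. *)
move=> t; pose a := Num.min t 0 - 1.
have [at' a0] : a < t /\ a < 0.
  by rewrite /a; split; rewrite ltrBlDr gt_min ltrDl ltr01 ?orbT // ltr_pwDr.
have QE u : a < u -> Q u = I a u - I a 0.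
  move=> au; rewrite /Q; case: ifPn => u0.
    by rewrite (Iadd a 0 u) ?(ltW a0)//; ring.
  by rewrite (Iadd a u 0) ?(ltW au)//; [ring|lra].
have tt : t < t + 1 by lra.
have [dI I'] := continuous_FTC1_closed tt
  (continuous_itv_integrable a (t + 1) cq) at' (cq t).
have E : {near t, (fun u => I a u - I a 0) =1 Q}.
  near=> u; rewrite QE//; near: u; exact: lt_nbhsr.
apply: (near_eq_is_derive E).
have dIt : is_derive t 1 (I a) (q t).
  by apply: DeriveDef => //; rewrite -derive1E.
by apply: is_derive_eq; rewrite subr0.
Unshelve. all: by end_near. Qed.

(** * A one-sided derivative criterion *)

(** This serves [|h| + K], which need not be differentiable at zeros of [h]. Allow a slack
    [e * (t - a)]: by continuity the supremum of the points obeying the slackened bound obeys it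
    too, and the right slope would push it further unless it is [b]. *)
Lemma right_slope_le0_le (R : realType) (f : R -> R) (a b : R) : a <= b ->
  (forall t, a <= t <= b -> {for t, continuous f}) ->
  (forall t e, a <= t < b -> 0 < e ->
    \forall s \near t^'+, f s <= f t + e * (s - t)) ->
  f b <= f a.
Proof.
move=> ab cf slope; suff le_e e : 0 < e -> f b <= f a + e * (b - a).
  have [->//|nab] := eqVneq a b.
  have ltab : 0 < b - a by rewrite subr_gt0 lt_neqAle nab.
  apply/ler_addgt0Pr => e e0.
  have := le_e (e / (b - a)) (divr_gt0 e0 ltab).
  by rewrite divfK ?gt_eqF.
move=> e0; pose A := [set t | a <= t <= b /\ f t <= f a + e * (t - a)].
have Aa : A a by split; [rewrite lexx | rewrite subrr mulr0 addr0].
have supA : has_sup A.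
  by split; [exists a | exists b => t [/andP[]]].
pose c := sup A.
have ac : a <= c by exact: sup_ubound supA.2 _ Aa.
have cb : c <= b by apply: sup_le_ub => [|t [/andP[]]//]; exists a.
have Ac : A c.
  split; first by rewrite ac cb.
  rewrite leNgt; apply/negP => fc.
  have cfc : {for c, continuous (fun t => f t - (f a + e * (t - a)))}.
    apply: cvgB; first by apply: cf; rewrite ac cb.
    apply: cvgD; first exact: cvg_cst.
    apply: cvgM; first exact: cvg_cst.
    by apply: cvgB; [exact: cvg_id | exact: cvg_cst].
  have : \forall t \near c, 0 < f t - (f a + e * (t - a)).
    by apply: (cvgr_gt _ cfc); rewrite subr_gt0.
  move=> /nbhs_ballP[d /= d0 dP].
  have [t At] := sup_adherent d0 supA; rewrite -/c => ct.
  have tc : t <= c by exact: sup_ubound supA.2 _ At.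
  have := dP t; rewrite /ball /= => /(_ _)/wrap[|].
    by rewrite ger0_norm ?subr_ge0//; lra.
  by rewrite subr_gt0 ltNge; case: At => _ ->.
have [<-|ncb] := eqVneq c b; first by case: Ac.
have ltcb : c < b by rewrite lt_neqAle ncb.
(* Points just to the right of [c] would belong to [A], although [c] is its supremum. *)
have : \forall s \near c^'+, False.
  near=> s.
  have cs : c < s by near: s; exact: nbhs_right_gt.
  have sb : s <= b by near: s; exact: nbhs_right_le.
  have fs : f s <= f c + e * (s - c).
    by near: s; apply: slope => //; rewrite ac ltcb.
  have As : A s.
    split; first by rewrite sb (le_trans ac (ltW cs)).
    case: Ac => _ fc; apply: (le_trans fs).
    rewrite (le_trans (lerD fc (lexx _)))//; lra.
  by have := sup_ubound supA.2 As; rewrite -/c leNgt cs.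
by move=> /filter_ex[].
Unshelve. all: by end_near. Qed.

Lemma is_derive_right_le (R : realType) (f : R -> R) (t d c e : R) :
  is_derive t (1 : R) f d -> 0 < e -> d <= c ->
  \forall s \near t^'+, f s <= f t + (c + e) * (s - t).
Proof.
move=> [df fd] e0 dc.
have := df; move/derivable1_diffP => _.
have : h^-1 *: (f (h *: 1 + t) - f t) @[h --> 0^'] --> d.
  by rewrite -fd; exact: df.
move=> /cvgrPdist_lt /(_ e e0) /nbhs_ballP [r /= r0 H].
near=> s.
have ts : t < s by near: s; exact: nbhs_right_gt.
have st : s < t + r.
  by near: s; apply: nbhs_right_lt; rewrite ltrDl.
have := H (s - t); rewrite /ball /= sub0r normrN gtr0_norm ?subr_gt0//.
move=> /(_ _)/wrap[|]; first by lra.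
rewrite subr_eq0 gt_eqF// => /(_ isT).
rewrite [_ *: 1]mulr1 subrK [_ *: _]mulrC ltr_norml => /andP[lt_e _].
have : (f s - f t) / (s - t) < c + e by lra.
by rewrite ltr_pdivrMr ?subr_gt0// => ?; lra.
Unshelve. all: by end_near. Qed.

(** Since [|h|] is the maximum of [h] and [-h], it suffices to control [h + K] and [-h + K]
    separately to the right of each point. At a zero of [h] both branches are active, so both sign
    hypotheses include that case. *)
Lemma normr_add_le_of_is_derive (R : realType) (h K h' k' : R -> R) (a b : R) :
  a <= b ->
  (forall t, a <= t <= b -> is_derive t (1 : R) h (h' t)) ->
  (forall t, a <= t <= b -> is_derive t (1 : R) K (k' t)) ->
  (forall t, a <= t <= b -> 0 <= h t -> h' t + k' t <= 0) ->
  (forall t, a <= t <= b -> h t <= 0 -> - h' t + k' t <= 0) ->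
  `|h b| + K b <= `|h a| + K a.
Proof.
move=> ab dh dK hpos hneg.
have ch t : a <= t <= b -> {for t, continuous h}.
  by move=> tab; apply: differentiable_continuous; apply/derivable1_diffP; case: (dh t tab).
have cK t : a <= t <= b -> {for t, continuous K}.
  by move=> tab; apply: differentiable_continuous; apply/derivable1_diffP; case: (dK t tab).
have half t e (s : R) : a <= t <= b -> 0 < e -> s = 1 \/ s = -1 ->
    \forall u \near t^'+, s * h u + K u <= `|h t| + K t + e * (u - t).
  move=> tab e0 s1.
  have := ch t tab; have := cK t tab => cKt cht.
  have sq : s * s = 1 by case: s1 => ->; ring.
  have [st|st] := lerP 0 (s * h t).
    have dsum : is_derive t (1 : R) (fun u => s * h u + K u) (s * h' t + k' t).
      have := dh t tab; have := dK t tab => dKt dht.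
      by apply: is_derive_eq.
    have le0 : s * h' t + k' t <= 0.
      by case: s1 st => -> st; [rewrite mul1r; apply: hpos; lra
                               |rewrite mulN1r; apply: hneg; lra].
    have := is_derive_right_le dsum e0 le0.
    apply: filterS => u; rewrite add0r => /le_trans; apply; rewrite lerD2r lerD2r.
    by rewrite -{1}(ger0_norm st) normrM; case: s1 => ->; rewrite ?normrN normr1 mul1r.
  (* This branch is inactive: it starts strictly below [|h t| + K t], and continuity keeps it there
     just after [t]. *)
  have cs : {for t, continuous (fun u => s * h u + K u)}.
    by apply: cvgD => //; apply: cvgM => //; exact: cvg_cst.
  have lt0 : s * h t + K t < `|h t| + K t.
    by rewrite ltrD2r (lt_le_trans st).
  near=> u.
  have tu : t < u by near: u; exact: nbhs_right_gt.
  apply: (@le_trans _ _ (`|h t| + K t)).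
    near: u; apply: cvg_within; exact: cvgr_le cs _ lt0.
  by rewrite lerDl mulr_ge0 ?ltW// subr_gt0.
apply: (@right_slope_le0_le _ (fun t => `|h t| + K t)) => //.
  by move=> t tab; apply: cvgD; [apply: cvg_norm; exact: ch|exact: cK].
move=> t e /andP[at' tb] e0.
have tab : a <= t <= b by rewrite at' ltW.
have := half t e 1 tab e0 (or_introl erefl).
have := half t e (-1) tab e0 (or_intror erefl).
apply: filterS2 => u; rewrite mulN1r mul1r /=.
by case: (lerP 0 (h u)) => hu; rewrite ?(ger0_norm hu) ?(ltr0_norm hu).
Unshelve. all: by end_near. Qed.

(** * Admissible rates *)

Lemma unif_continuous_continuous (U V : uniformType) (f : U -> V) :
  unif_continuous f -> continuous f.
Proof.
move=> uf x; apply/cvg_entourageP => E entE.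
have := uf E entE; move=> H; apply/nbhsP.
by exists [set p | E (f p.1, f p.2)] => // y /xsectionP.
Qed.

Lemma bounded_funP_ex (R : realType) (T : Type) (V : normedModType R) (f : T -> V) :
  bounded_fun f -> exists2 M, 0 < M & forall t, `|f t| <= M.
Proof.
move=> [M [_ H]]; exists (Num.max M 0 + 1) => [|t].
  by rewrite ltr_wpDl// le_max lexx orbT.
by apply: H => //; rewrite ltr_pwDr// le_max lexx.
Qed.

Section Rate.
Context {R : realType} (f : R -> R -> R).
Hypothesis admf : C1_admissible f.
Hypothesis monf : forall t, nondecreasing_fun (f t).

Lemma rate_is_derive t v : is_derive v (1 : R) (f t) (dv f t v).
Proof. by case: admf => df _ _ _; apply: DeriveDef; rewrite /dv ?derive1E. Qed.

Lemma rate_continuous_var t : continuous (f t).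
Proof.
move=> v; apply: differentiable_continuous; apply/derivable1_diffP.
by case: (rate_is_derive t v).
Qed.

Lemma rate_continuous_time v : continuous (f ^~ v).
Proof. by case: admf => _ _ /(_ v)[+ _] _; exact: unif_continuous_continuous. Qed.

(** Admissibility bounds [f] only along each line of constant [v]; monotonicity traps the values in
    between by those at [B] and [- B]. *)
Lemma rate_bounded (B : R) : exists2 M : R, 0 < M &
  forall t v, `|v| <= B -> `|f t v| <= M.
Proof.
case: admf => _ _ bf _.
have [M1 M10 HM1] := bounded_funP_ex (bf B).2.
have [M2 M20 HM2] := bounded_funP_ex (bf (- B)).2.
exists (M1 + M2) => [|t v]; first exact: addr_gt0.
rewrite ler_norml => /andP[Bv vB].
have := monf t Bv; have := monf t vB.
have := HM1 t; have := HM2 t; rewrite !ler_norml => /andP[? ?] /andP[? ?] ? ?.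
by apply/andP; split; lra.
Qed.

(** Separate continuity suffices because of monotonicity: [f s (z s)] is squeezed between
    [f s (z t - d)] and [f s (z t + d)], which are continuous in [s] at fixed second argument. *)
Lemma rate_continuous_comp (z : R -> R) : continuous z -> continuous (fun t => f t (z t)).
Proof.
move=> cz t; apply/cvgrPdist_le => e e0.
have /cvgrPdist_lt/(_ _ (divr_gt0 e0 (ltr0Sn R 1)))/nbhs_ballP[r /= r0 H] :=
  @rate_continuous_var t (z t).
pose d := r / 2; have d0 : 0 < d by rewrite divr_gt0.
have bnd s : `|s| <= d -> `|f t (z t) - f t (z t + s)| < e / 2.
  move=> sd; apply: H; rewrite /ball /= opprD addNKr normrN.
  by rewrite (le_lt_trans sd)// /d; lra.
have := bnd d; have := bnd (- d); rewrite normrN (gtr0_norm d0) lexx.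
move=> /(_ isT) + /(_ isT); rewrite !ltr_norml => /andP[b1 b2] /andP[b3 b4].
near=> s.
have zs : `|z t - z s| <= d.
  by near: s; have /cvgrPdist_le := cz t; apply.
have ts1 : `|f t (z t - d) - f s (z t - d)| <= e / 2.
  by near: s; have /cvgrPdist_le := @rate_continuous_time (z t - d) t; apply; lra.
have ts2 : `|f t (z t + d) - f s (z t + d)| <= e / 2.
  by near: s; have /cvgrPdist_le := @rate_continuous_time (z t + d) t; apply; lra.
move: zs ts1 ts2; rewrite !ler_norml => /andP[? ?] /andP[? ?] /andP[? ?].
have m1 : f s (z s) <= f s (z t + d) by apply: monf; lra.
have m2 : f s (z t - d) <= f s (z s) by apply: monf; lra.
by apply/andP; split; lra.
Unshelve. all: by end_near. Qed.

Lemma rate_mean_value t u v : u < v ->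
  exists2 c, c \in `]u, v[ & f t v - f t u = dv f t c * (v - u).
Proof.
move=> uv; apply: MVT => //; first by move=> x _; exact: rate_is_derive.
exact/continuous_subspaceT/rate_continuous_var.
Qed.

Hypothesis carries : forall v, 0 <= v -> exists2 delta, 0 < delta &
  forall t, delta <= dv f t v.

(* The bound [delta] above depends on [v] with no uniformity; Baire's theorem
   still yields a subinterval of [p, q] on which some bound holds uniformly. *)
Lemma rate_increase_lower_bound p q : 0 <= p -> p < q ->
  exists2 rho, 0 < rho & forall t, rho <= f t q - f t p.
Proof.
move=> p0 pq; apply: contrapT => nrho.
have small rho : 0 < rho -> exists t, f t q - f t p < rho.
  move=> rho0; apply: contrapT => nt; apply: nrho; exists rho => // t.
  by rewrite leNgt; apply/negP => lt; apply: nt; exists t.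
(* The points where the derivative falls below [1 / (n + 1)] at some time, enlarged by the
   complement of [[p, q]] so that the set is dense in the whole line. *)
pose O (n : nat) : set R^o :=
  \bigcup_t [set u | dv f t u < n.+1%:R^-1] `|` [set u | u < p] `|` [set u | q < u].
have od n : open (O n) /\ dense (O n).
  split.
    apply: openU; last exact: open_gt.
    apply: openU; last exact: open_lt.
    apply: bigcup_open => t _.
    have cd : continuous (dv f t) by case: admf.
    by move/continuousP : cd => /(_ _ (@open_lt _ (n.+1%:R^-1 : R))).
  move=> U [u Uu] oU.
  have [up|pu] := ltP u p; first by exists u; split => //; left; right.
  have [qu|uq] := ltP q u; first by exists u; split => //; right.
  have /nbhs_ballP[r /= r0 rU] := oU u Uu.
  pose p' := Num.max p (u - r / 2); pose q' := Num.min q (u + r / 2).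
  have pq' : p' < q'.
    by rewrite /p' /q' gt_max !lt_min; apply/andP; split; apply/andP; split; lra.
  have [pp' qq'] : p <= p' /\ q' <= q by rewrite le_max ge_min !lexx.
  have [up' uq'] : u - r / 2 <= p' /\ q' <= u + r / 2 by rewrite le_max ge_min !lexx !orbT.
  (* A small increase over [[p, q]] is small over [[p', q']] by monotonicity, and the mean value
     theorem then finds a point of [O n] inside [U]. *)
  have : 0 < (q' - p') / n.+1%:R by rewrite divr_gt0 ?subr_gt0.
  move=> /small[t tlt].
  have [c /[!in_itv]/= /andP[pc cq] cE] := rate_mean_value t pq'.
  exists c; split.
    by apply: rU; rewrite /ball /= ltr_distlC; apply/andP; split; lra.
  left; left; exists t => //=.
  have := monf t pp'; have := monf t qq' => ? ?.
  have : dv f t c * (q' - p') < n.+1%:R^-1 * (q' - p').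
    by rewrite -cE [ltRHS]mulrC (le_lt_trans _ tlt)// lerB.
  by rewrite ltr_pM2r ?subr_gt0.
(* A point of []p, q[] lying in every [O n] has derivatives arbitrarily close to [0] along time,
   against [carries] at that point. *)
have dO := Baire od.
have [|u [/= /[!in_itv]/= /andP[pu uq] Ou]] := dO `]p, q[%classic _ (itv_open p q).
  by exists ((p + q) / 2); rewrite /= in_itv /=; apply/andP; split; lra.
have [|d d0 dP] := carries (v := u); first by lra.
have [n _ nd] := near_infty_natSinv_lt (PosNum d0).
have nd' : n.+1%:R^-1 < d := nd n (leqnn n).
have [[[t _ /= tu]|/= up]|/= qu] := Ou n I.
- by have := lt_trans tu nd'; rewrite ltNge dP.
- by have := lt_trans pu up; rewrite ltxx.
- by have := lt_trans uq qu; rewrite ltxx.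
Qed.

(** Cut [[0, B]] into cells of length [eta / 2]. Any interval of length at least [eta] in it
    contains a whole cell, and there are finitely many cells, so the least of their increase bounds
    works for all. *)
Lemma rate_gap (B eta : R) : 0 < eta -> exists2 rho, 0 < rho &
  forall t u v, 0 <= u -> v <= B -> u + eta <= v -> rho <= f t v - f t u.
Proof.
move=> eta0; pose c := eta / 2; have c0 : 0 < c by rewrite divr_gt0.
have grid (N : nat) : exists2 rho, 0 < rho & forall k t, (k < N)%N ->
    rho <= f t (k.+1%:R * c) - f t (k%:R * c).
  elim: N => [|N [r r0 IH]]; first by exists 1.
  have [||r' r'0 H'] := @rate_increase_lower_bound (N%:R * c) (N.+1%:R * c).
  - by rewrite mulr_ge0// ltW.
  - by rewrite ltr_pM2r// ltr_nat.
  exists (Num.min r r') => [|k t]; first by rewrite lt_min r0.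
  rewrite ltnS leq_eqVlt => /orP[/eqP ->|kN]; rewrite ge_min.
    by rewrite H' orbT.
  by rewrite IH.
have [rho rho0 H] := grid (Num.trunc (B / c)).+1.
exists rho => // t u v u0 vB uv.
have uc0 : 0 <= u / c by rewrite divr_ge0// ltW.
(* [k] indexes the first grid point strictly beyond [u]; it is at most [u + c] away from the origin,
   so the cell starting there ends before [v]. *)
pose k := (Num.trunc (u / c)).+1.
have /andP[k1 k2] := truncn_itv uc0.
have ku : u < k%:R * c by rewrite -ltr_pdivrMr.
have ku' : k%:R * c <= u + c.
  by rewrite /k -natr1 mulrDl mul1r lerD2r -ler_pdivlMr.
have cE : c + c = eta by rewrite /c; lra.
have kv : k.+1%:R * c <= v by rewrite -natr1 mulrDl mul1r; lra.
have kN : (k < (Num.trunc (B / c)).+1)%N.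
  have Bc : (k%:R : R) <= B / c.
    by rewrite ler_pdivlMr//; move: kv; rewrite -natr1 mulrDl mul1r; lra.
  rewrite ltnS truncn_ge_nat//; exact: le_trans Bc.
apply: le_trans (H k t kN) _.
have := monf t kv; have := monf t (ltW ku); lra.
Qed.

End Rate.

(** * Quasimonotonicity *)

Section EtaIntegral.
Context {R : realType} {m : nat}.
Variables (g : 'I_m.+1 -> 'I_m -> R -> R -> R) (mu nu : 'I_m -> 'I_m -> pastMeasure R).
Hypothesis admg : forall i j, C1_admissible (g i j).
Hypothesis mong : forall i j t, nondecreasing_fun (g i j t).
Hypothesis heta : eta_hyp mu nu g.

Lemma rate_dv_ge0 i j t v : 0 <= dv (g i j) t v.
Proof.
rewrite leNgt; apply/negP => d0.
have e0 : 0 < - dv (g i j) t v / 2 by rewrite divr_gt0 ?oppr_gt0.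
have := is_derive_right_le (rate_is_derive (admg i j) t v) e0 (lexx _).
move=> /(filterI (nbhs_right_gt v)) /filter_ex[s [vs fs]].
have : (dv (g i j) t v + - dv (g i j) t v / 2) * (s - v) < 0.
  by rewrite nmulr_rlt0 ?subr_gt0//; lra.
have := mong i j t (ltW vs); lra.
Qed.

(** Taking [fine] is faithful here, since the infimum lies between [0] and one derivative value. The
    supremum [dv_sup] can be infinite and therefore stays an extended real. *)
Definition cinf i j : R := fine (dv_inf g i j).

Lemma dv_infE i j : dv_inf g i j = (cinf i j)%:E.
Proof.
rewrite /cinf fineK// fin_numE; apply/andP; split.
  rewrite -ltNye (@lt_le_trans _ _ 0%E)// le_ereal_inf_tmp// => _ [p _ <-].
  by rewrite lee_fin rate_dv_ge0.
rewrite -ltey (@le_lt_trans _ _ (dv (g i j) 0 0)%:E) ?ltry//.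
by apply: ereal_inf_lbound; exists (0, 0).
Qed.

Lemma cinf_le i j t v : cinf i j <= dv (g i j) t v.
Proof. by rewrite -lee_fin -dv_infE; apply: ereal_inf_lbound; exists (t, v). Qed.

Lemma cinf_ge0 i j : 0 <= cinf i j.
Proof.
rewrite -lee_fin -dv_infE; apply: le_ereal_inf_tmp => _ [p _ <-].
by rewrite lee_fin rate_dv_ge0.
Qed.

Lemma dv_sup_ge0 i j : (0 <= dv_sup g i j)%E.
Proof.
apply: (@le_trans _ _ (dv (g i j) 0 0)%:E); first by rewrite lee_fin rate_dv_ge0.
by apply: ereal_sup_ubound; exists (0, 0).
Qed.

Lemma rate_diff_ge i j t u v : u <= v -> cinf i j * (v - u) <= g i j t v - g i j t u.
Proof.
rewrite le_eqVlt => /predU1P[->|uv]; first by rewrite !subrr mulr0.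
have [c _ ->] := rate_mean_value (admg i j) t uv.
by rewrite ler_wpM2r ?subr_ge0 ?(ltW uv)// cinf_le.
Qed.

Lemma rate_diff_le i j t u v : u <= v ->
  ((g i j t v - g i j t u)%:E <= dv_sup g i j * (v - u)%:E)%E.
Proof.
rewrite le_eqVlt => /predU1P[->|uv]; first by rewrite !subrr mule0.
have [c _ ->] := rate_mean_value (admg i j) t uv.
rewrite EFinM lee_wpmul2r ?lee_fin ?subr_ge0 ?(ltW uv)//.
by apply: ereal_sup_ubound; exists (t, c).
Qed.

Lemma EFin_Rintegral_past (rho : pastMeasure R) (f : past R -> R) (M : R) :
  continuous f -> (forall s, `|f s| <= M) ->
  (\int[rho]_s f s)%:E = (\int[rho]_s (f s)%:E)%E.
Proof.
move=> cf fM; rewrite /Rintegral fineK//.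
by apply: integrable_fin_num => //; exact: integrable_past cf fM.
Qed.

(** [eta_hyp] compares the scaled measures set by set; integrating a nonnegative function against
    both sides gives the claim when the total of the [dv_sup g k i] is finite. The infinite case is
    settled separately. *)
Lemma eta_integral i j (f : past R -> R) (M : R) :
  continuous f -> (forall s, 0 <= f s <= M) ->
  (\sum_(k < m.+1) dv_sup g k i * (\int[nu i j]_s f s)%:E
    <= (cinf (cmpt i) j * \int[mu i j]_s f s)%:E)%E.
Proof.
move=> cf f0M.
have f0 s : 0 <= f s by case/andP: (f0M s).
have fM s : `|f s| <= M by rewrite ger0_norm//; case/andP: (f0M s).
rewrite -ge0_sume_distrl; last by move=> k _; exact: dv_sup_ge0.
set d := (\sum_(k < m.+1) _)%E.
have d0 : (0 <= d)%E by apply: sume_ge0 => k _; exact: dv_sup_ge0.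
have dle A : measurable A -> (d * nu i j A <= (cinf (cmpt i) j)%:E * mu i j A)%E.
  move=> mA; have := heta i j mA; rewrite -ge0_sume_distrl; last first.
    by move=> k _; exact: dv_sup_ge0.
  rewrite dv_infE sube_ge0//; apply/orP; right.
  by rewrite fin_numM// fin_num_measure.
rewrite EFinM !(EFin_Rintegral_past _ cf fM).
case: d d0 dle => [d d0' dle|_ dle|//].
  have d0 : 0 <= d by rewrite -lee_fin.
  pose c := NngNum (cinf_ge0 (cmpt i) j); pose dd := NngNum d0.
  have mf := (measurable_EFinP _ _).2 (continuous_past_measurable cf).
  have := @ge0_le_measure_integral _ _ R (mscale dd (nu i j)) (mscale c (mu i j))
    dle _ setT measurableT _ mf.
  rewrite !ge0_integral_mscale//=; first last.
  - by move=> s _; rewrite lee_fin.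
  - by move=> s _; rewrite lee_fin.
  by apply => // s; rewrite lee_fin.
(* An infinite total coefficient forces [nu i j] to be null: otherwise the finite number
   [cinf (cmpt i) j] times the mass of [mu i j] would dominate an infinite one. *)
have nu0 : nu i j setT = 0%E.
  have := dle setT measurableT.
  have := measure_ge0 (nu i j) setT; rewrite le_eqVlt => /predU1P[<-//|nu0].
  rewrite gt0_mulye// leye_eq => /eqP muy.
  have : ((cinf (cmpt i) j)%:E * mu i j setT)%E \is a fin_num.
    by rewrite fin_numM// fin_num_measure.
  by rewrite muy.
rewrite (@null_set_integral _ _ _ (nu i j) setT)//; last first.
  by apply/measurable_EFinP; exact: continuous_past_measurable.
rewrite mule0; apply: mule_ge0; first by rewrite lee_fin cinf_ge0.
by apply: integral_ge0 => s _; rewrite lee_fin.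
Qed.
End EtaIntegral.

Lemma continuous_shift_past (R : realType) (phi : R -> R) t :
  continuous phi -> continuous (fun s : past R => phi (t + set_val s)).
Proof.
move=> cphi s.
apply: (@continuous_comp _ _ _ set_val (fun x => phi (t + x))).
  exact: continuous_past_val.
apply: continuous_comp; last exact: cphi.
by apply: cvgD; [exact: cvg_cst | exact: cvg_id].
Qed.

Section Gap.
Context {R : realType} {m : nat}.
Variables (g : 'I_m.+1 -> 'I_m -> R -> R -> R) (mu nu : 'I_m -> 'I_m -> pastMeasure R).
Hypothesis admg : forall i j, C1_admissible (g i j).
Hypothesis mong : forall i j t, nondecreasing_fun (g i j t).

Definition gap (X Y : 'I_m -> R -> R) i j t : R := g i j t (X j t) - g i j t (Y j t).

Lemma gap_continuous X Y i j : continuous (X j) -> continuous (Y j) ->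
  continuous (gap X Y i j).
Proof.
by move=> cX cY t; apply: cvgB; apply: (rate_continuous_comp (admg i j) (@mong i j)).
Qed.

Lemma gap_bounded X Y B i j : (forall t, `|X j t| <= B) -> (forall t, `|Y j t| <= B) ->
  exists2 M, 0 < M & forall t, `|gap X Y i j t| <= M.
Proof.
move=> bX bY; have [M M0 HM] := rate_bounded (admg i j) (@mong i j) B.
exists (M + M) => [|t]; first exact: addr_gt0.
by rewrite (le_trans (ler_normB _ _))// lerD// HM.
Qed.

Lemma gap_ge0 X Y i j t : Y j t <= X j t -> 0 <= gap X Y i j t.
Proof. by move=> YX; rewrite subr_ge0 mong. Qed.

Lemma gap_le0 X Y i j t : X j t <= Y j t -> gap X Y i j t <= 0.
Proof. by move=> YX; rewrite subr_le0 mong. Qed.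

Lemma gapC X Y i j t : gap Y X i j t = - gap X Y i j t.
Proof. by rewrite /gap opprB. Qed.

Hypothesis heta : eta_hyp mu nu g.

(* The quasimonotonicity estimate: [eta_hyp] lets the inflow into compartment i
   pay for the outflow when [X i t - Y i t] and the neutral difference have
   opposite signs. *)
Lemma neutral_gap_le (X Y : 'I_m -> R -> R) (B : R) (i : 'I_m) (t : R) :
  (forall j, continuous (X j)) -> (forall j, continuous (Y j)) ->
  (forall j t, `|X j t| <= B) -> (forall j t, `|Y j t| <= B) ->
  0 <= (X i t - Y i t)
       - \sum_j \int[nu i j]_s (X j (t + set_val s) - Y j (t + set_val s)) ->
  - (\sum_k gap X Y k i t)
    + \sum_j \int[mu i j]_s gap X Y (cmpt i) j (t + set_val s)
  <= - (\sum_k `|gap X Y k i t|)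
    + \sum_j \int[mu i j]_s `|gap X Y (cmpt i) j (t + set_val s)|.
Proof.
move=> cX cY bX bY h0.
pose G j (s : past R) : R := gap X Y (cmpt i) j (t + set_val s).
have cG j : continuous (G j) by apply: continuous_shift_past; exact: gap_continuous.
have iG j (rho : pastMeasure R) : rho.-integrable setT (EFin \o G j).
  have [M _ HM] := gap_bounded (cmpt i) (bX j) (bY j).
  by apply: (@integrable_past _ _ _ M) => // s; exact: HM.
have inG j (rho : pastMeasure R) : rho.-integrable setT (EFin \o (fun s => `|G j s|)).
  have [M _ HM] := gap_bounded (cmpt i) (bX j) (bY j).
  apply: (@integrable_past _ _ _ M) => [|s]; last by rewrite normr_id HM.
  apply: (@continuous_shift_past _ (fun x => `|gap X Y (cmpt i) j x|)) => x.
  by apply: cvg_norm; exact: gap_continuous.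
have iNG j (rho : pastMeasure R) :
    rho.-integrable setT (EFin \o (fun s => `|G j s| - G j s)).
  have [M _ HM] := gap_bounded (cmpt i) (bX j) (bY j).
  apply: (@integrable_past _ _ _ (M + M)) => [|s]; last first.
    by rewrite (le_trans (ler_normB _ _))// normr_id lerD// HM.
  apply: (@continuous_shift_past _
    (fun x => `|gap X Y (cmpt i) j x| - gap X Y (cmpt i) j x)) => x.
  apply: cvgB; last exact: gap_continuous.
  by apply: cvg_norm; exact: gap_continuous.
(* If [Y i t <= X i t], all outgoing gaps are nonnegative: absolute values leave the outflow
   unchanged and only enlarge the inflow. *)
have [YX|XY] := lerP (Y i t) (X i t).
  apply: lerD; first by rewrite lerN2; apply: ler_sum => k _; rewrite ger0_norm// gap_ge0.
  apply: ler_sum => j _; apply: le_Rintegral; [by []|exact: iG|exact: inG|].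
  by move=> s _; exact: ler_norm.
pose w j (s : past R) : R := Num.max (Y j (t + set_val s) - X j (t + set_val s)) 0.
pose w0 j (s : past R) : R := X j (t + set_val s) - Y j (t + set_val s).
have cwR j : continuous (fun x => X j x - Y j x : R).
  by move=> x; apply: (cvgB (cX j x) (cY j x)).
have cw0 j : continuous (w0 j) by exact: (@continuous_shift_past _ _ t (cwR j)).
have bw0 j s : `|w0 j s| <= B + B.
  by rewrite (le_trans (ler_normB _ _))// lerD.
have cwmR j : continuous (fun x => Num.max (Y j x - X j x) 0 : R).
  move=> x; apply: (@continuous_max _ _ (fun x => Y j x - X j x)); last exact: cvg_cst.
  exact: (cvgB (cY j x) (cX j x)).
have cw j : continuous (w j) by exact: (@continuous_shift_past _ _ t (cwmR j)).
have w_ge0 j s : 0 <= w j s by rewrite /w le_max lexx orbT.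
have B0 : 0 <= B by exact: le_trans (normr_ge0 _) (bX i t).
have bw j s : 0 <= w j s <= B + B.
  rewrite w_ge0/= /w ge_max addr_ge0// andbT.
  by have := bw0 j s; rewrite /w0 ler_norml => /andP[? _]; lra.
have bnw j s : `|w j s| <= B + B by rewrite ger0_norm//; case/andP: (bw j s).
have iw j (rho : pastMeasure R) : rho.-integrable setT (EFin \o w j).
  by apply: (@integrable_past _ _ _ (B + B)).
have iw0 j (rho : pastMeasure R) : rho.-integrable setT (EFin \o w0 j).
  by apply: (@integrable_past _ _ _ (B + B)).
(* Nonnegativity of the neutral difference bounds the present deficit by the past deficits [w]
   weighted by [nu]. *)
have wi : Y i t - X i t <= \sum_j \int[nu i j]_s w j s.
  have : - (\sum_j \int[nu i j]_s w j s) <= \sum_j \int[nu i j]_s w0 j s.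
    rewrite -sumrN; apply: ler_sum => j _.
    rewrite lerNl -[leLHS]mulN1r -RintegralZl//; last exact: iw0.
    apply: le_Rintegral; [by []| |exact: iw|].
      apply: (@integrable_past _ _ _ (B + B)) => [|s]; last by rewrite mulN1r normrN.
      apply: (@continuous_shift_past _ (fun x => -1 * (X j x - Y j x))) => x.
      by apply: cvgM; [exact: cvg_cst|exact: cwR].
    by move=> s _; rewrite mulN1r /w /w0 opprB le_max lexx.
  by move: h0; rewrite -/(w0 _ _); lra.
(* Each outgoing gap is at most [dv_sup] times the deficit, hence at most a [nu]-integral of [w];
   [eta_integral] trades it for a [mu]-integral. *)
have key : \sum_k `|gap X Y k i t| <= \sum_j cinf g (cmpt i) j * \int[mu i j]_s w j s.
  rewrite -lee_fin -!sumEFin.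
  apply: (@le_trans _ _ (\sum_(k < m.+1) dv_sup g k i * (\sum_j \int[nu i j]_s w j s)%:E)%E).
    apply: lee_sum => k _; rewrite ler0_norm ?gap_le0 ?(ltW XY)// /gap opprB.
    apply: le_trans (rate_diff_le admg k i t (ltW XY)) _.
    by rewrite lee_wpmul2l ?lee_fin ?dv_sup_ge0.
  rewrite (eq_bigr (fun k => \sum_j dv_sup g k i * (\int[nu i j]_s w j s)%:E)%E).
    rewrite exchange_big/=; apply: lee_sum => j _.
    exact: (eta_integral admg mong heta i j (cw j) (bw j)).
  move=> k _; rewrite -sumEFin ge0_sume_distrr// => j _.
  by rewrite lee_fin Rintegral_ge0.
(* Where [w] is positive, [G] is nonpositive and [|G| - G] is [2 |G|]; elsewhere the left integrand
   is [0]. The factor 2 pays for reversing the sign of the outflow. *)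
have cmp : 2 * \sum_j cinf g (cmpt i) j * \int[mu i j]_s w j s <=
    \sum_j \int[mu i j]_s (`|G j s| - G j s).
  rewrite mulr_sumr; apply: ler_sum => j _.
  rewrite mulrA -RintegralZl//; last exact: iw.
  apply: le_Rintegral; [by []| | |move=> s _].
  - apply: (@integrable_past _ _ _ (2 * cinf g (cmpt i) j * (B + B))) => [|s].
      apply: (@continuous_shift_past _
        (fun x => 2 * cinf g (cmpt i) j * Num.max (Y j x - X j x) 0)) => x.
      by apply: cvgM; [exact: cvg_cst|exact: cwmR].
    rewrite normrM ger0_norm ?mulr_ge0 ?(cinf_ge0 admg mong)//.
    by rewrite ler_wpM2l ?mulr_ge0 ?(cinf_ge0 admg mong).
  - exact: iNG.
  rewrite /w. have [h|h] := lerP (Y j (t + set_val s)) (X j (t + set_val s)).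
    by rewrite max_r ?subr_le0// mulr0 subr_ge0 ler_norm.
  rewrite max_l; last by rewrite subr_ge0 ltW.
  rewrite ler0_norm; last exact: gap_le0 (ltW h).
  have := rate_diff_ge admg mong (cmpt i) j (t + set_val s) (ltW h).
  by rewrite /G /gap; lra.
have -> : - (\sum_k gap X Y k i t) = \sum_k `|gap X Y k i t|.
  by rewrite -sumrN; apply: eq_bigr => k _; rewrite ler0_norm// gap_le0// ltW.
have : \sum_j \int[mu i j]_s (`|G j s| - G j s) =
    \sum_j \int[mu i j]_s `|G j s| - \sum_j \int[mu i j]_s G j s.
  by rewrite -sumrB; apply: eq_bigr => j _; rewrite RintegralB//; [exact: inG|exact: iG].
by rewrite /G => E; lra.
Qed.
End Gap.

(** * The flow budget *)

Lemma continuous_comp_past (R : realType) (phi : R -> R) :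
  continuous phi -> continuous (fun s : past R => phi (set_val s)).
Proof.
move=> cphi s; apply: (@continuous_comp _ _ _ set_val phi); last exact: cphi.
exact: continuous_past_val.
Qed.

Lemma Rintegral_past_le (R : realType) (rho : pastMeasure R) (f : past R -> R) (M : R) :
  continuous f -> (forall s, `|f s| <= M) ->
  `|\int[rho]_s f s| <= M * fine (rho setT).
Proof.
move=> cf fM.
rewrite (le_trans (le_normr_Rintegral _ (integrable_past rho cf fM)))//.
rewrite -[leRHS](Rintegral_cst rho measurableT); apply: le_Rintegral => //.
- apply: (@integrable_past _ _ _ M) => [s|s]; last by rewrite normr_id.
  by apply: (@continuous_comp _ _ _ f Num.norm); [exact: cf|exact: norm_continuous].
- apply: (@integrable_past _ _ _ `|M|) => s //.
  exact: cst_continuous.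
Qed.

Lemma Rintegral_pastN (R : realType) (rho : pastMeasure R) (f : past R -> R) (M : R) :
  continuous f -> (forall s, `|f s| <= M) ->
  \int[rho]_s (- f s) = - \int[rho]_s f s.
Proof.
move=> cf fM; rewrite -mulN1r -RintegralZl//; last exact: integrable_past cf fM.
by apply: eq_Rintegral => s _; rewrite mulN1r.
Qed.

(** * Primitives of flows delayed by a transit time *)

Section DelayedPrimitive.
Context {R : realType}.
Variables (rho : pastMeasure R) (q Q : R -> R) (M : R).
Hypotheses (qM : forall t, `|q t| <= M)
  (dQ : forall t, is_derive t (1 : R) Q (q t)).

Lemma primitive_continuous : continuous Q.
Proof.
by move=> t; apply: differentiable_continuous; apply/derivable1_diffP; case: (dQ t).
Qed.

Lemma primitive_lipschitz a b : a <= b -> `|Q b - Q a| <= M * (b - a).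
Proof.
move=> ab.
have [//|c _ ->] := @MVT_segment R Q q a b ab.
  exact/continuous_subspaceT/primitive_continuous.
by rewrite normrM (ger0_norm (x := b - a)) ?subr_ge0// ler_wpM2r ?subr_ge0.
Qed.

(** Subtracting [Q (set_val s)] bounds the integrand by [M * |t|], although [Q] itself may be
    unbounded on the past. *)
Definition delayed_primitive t := \int[rho]_s (Q (t + set_val s) - Q (set_val s)).

Lemma primitive_shift_continuous t :
  continuous (fun s : past R => Q (t + set_val s) - Q (set_val s)).
Proof.
apply: (@continuous_comp_past _ (fun x => Q (t + x) - Q x)) => x.
apply: cvgB; last exact: primitive_continuous.
apply: continuous_comp; last exact: primitive_continuous.
by apply: cvgD; [exact: cvg_cst | exact: cvg_id].
Qed.

Lemma primitive_shift_bounded t (s : past R) :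
  `|Q (t + set_val s) - Q (set_val s)| <= M * `|t|.
Proof.
have [t0|t0] := lerP 0 t.
  have /primitive_lipschitz : set_val s <= t + set_val s by rewrite lerDr.
  by rewrite addrK ?(ger0_norm t0).
have /primitive_lipschitz : t + set_val s <= set_val s by rewrite gerDr ltW.
by rewrite distrC opprD addrCA subrr addr0 ?(ltr0_norm t0).
Qed.

Lemma is_derive_comp_addr (f : R -> R) (d t x : R) :
  is_derive (x + t) (1 : R) f d -> is_derive x (1 : R) (fun u => f (u + t)) d.
Proof.
move=> fd; have := @is_derive1_comp R f (fun u => u + t) x d 1.
rewrite mulr1; apply => //.
by apply: is_derive_eq; rewrite ?addr0.
Qed.

(** Differentiation under the integral sign, with the constant [M] as dominating function. *)
Lemma is_derive_delayed_primitive t :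
  is_derive t (1 : R) delayed_primitive (\int[rho]_s q (t + set_val s)).
Proof.
have M0 : 0 <= M by exact: le_trans (normr_ge0 _) (qM 0).
have dshift x (s : past R) :
    is_derive x (1 : R) (fun u => Q (u + set_val s) - Q (set_val s)) (q (x + set_val s)).
  have := is_derive_comp_addr (dQ (x + set_val s)) => ?.
  by apply: is_derive_eq; rewrite subr0.
pose f (u : R) (s : past R) : R := Q (u + set_val s) - Q (set_val s).
have partE x s : partial1of2 f x s = q (x + set_val s).
  by rewrite /partial1of2 derive1E; case: (dshift x s).
have tI : `]t - 1, t + 1[%classic t by rewrite /= in_itv/=; apply/andP; split; lra.
have int_f x : `]t - 1, t + 1[%classic x -> rho.-integrable setT (EFin \o f x).
  move=> _; apply: (@integrable_past _ _ _ (M * `|x|)).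
    exact: primitive_shift_continuous.
  exact: primitive_shift_bounded.
have der_f x s : `]t - 1, t + 1[%classic x -> setT s -> derivable (f ^~ s) x 1.
  by move=> _ _; case: (dshift x s).
have int_M : rho.-integrable setT (EFin \o (cst M : past R -> R)).
  by apply: (@integrable_past _ _ _ `|M|) => // s; exact: cst_continuous.
have ub x s : `]t - 1, t + 1[%classic x -> setT s ->
  `|partial1of2 f x s| <= (cst M : past R -> R) s by rewrite partE.
have F' := cvg_differentiation_under_integral measurableT tI int_f der_f
  (fun=> M0) int_M ub.
have -> : \int[rho]_s q (t + set_val s) = \int[rho]_s partial1of2 f t s.
  by apply: eq_Rintegral => s _; rewrite partE.
apply: DeriveDef.
  apply/cvg_ex; eexists; under eq_fun do rewrite scaler1; exact: F'.
apply/cvg_lim => //.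
by under eq_fun do rewrite scaler1; exact: F'.
Qed.
End DelayedPrimitive.

Section DelayedBound.
Context {R : realType}.
Variables (rho : pastMeasure R) (q Q : R -> R) (M : R).
Hypotheses (q0 : forall t, 0 <= q t) (qM : forall t, q t <= M)
  (dQ : forall t, is_derive t (1 : R) Q (q t)) (Q0 : Q 0 = 0).
Hypotheses (rho1 : rho setT = 1%E)
  (mom : (\int[rho]_s `|set_val (s : past R)|%:E < +oo)%E).

Lemma primitive_le a b : a <= b -> Q a <= Q b.
Proof.
move=> ab; rewrite -subr_ge0.
have [//|c _ ->] := @MVT_segment R Q q a b ab.
  exact/continuous_subspaceT/(primitive_continuous dQ).
by rewrite mulr_ge0 ?subr_ge0.
Qed.

(** Monotonicity gives [Q s <= 0] for [s <= 0], and the Lipschitz bound gives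
    [Q (- T + s) >= Q (- T) - M |s|]. Since [rho] has mass 1 and finite first moment, the delay
    costs a constant independent of [T]. *)
Lemma delayed_primitive_ge T : 0 <= T ->
  Q (- T) - M * \int[rho]_s `|set_val s| <= delayed_primitive rho Q (- T).
Proof.
move=> T0.
have qM' t : `|q t| <= M by rewrite ger0_norm.
have cabs : continuous (fun s : past R => `|set_val s|).
  exact: (@continuous_comp_past _ (fun x => `|x|) (@norm_continuous _ _)).
have iabs : rho.-integrable setT (EFin \o (fun s : past R => `|set_val s|)).
  apply/integrableP; split.
    by apply/measurable_EFinP; exact: continuous_past_measurable.
  by under eq_integral do rewrite /= normr_id.
have iMabs : rho.-integrable setT (EFin \o (fun s : past R => M * `|set_val s|)).
  exact: (integrableZl measurableT M iabs).
have icst : rho.-integrable setT (EFin \o (cst (Q (- T)) : past R -> R)).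
  by apply: (@integrable_past _ _ _ `|Q (- T)|) => // s; exact: cst_continuous.
have -> : Q (- T) - M * \int[rho]_s `|set_val s| =
    \int[rho]_s (Q (- T) - M * `|set_val s|).
  rewrite RintegralB// RintegralZl//; congr (_ - _).
  rewrite Rintegral_cst//.
  by transitivity (Q (- T) * fine (rho setT)); [rewrite rho1 /= mulr1|].
apply: le_Rintegral => //.
- exact: (integrableB measurableT icst iMabs).
- apply: (@integrable_past _ _ _ (M * `|- T|)).
    exact: primitive_shift_continuous dQ _.
  exact: (primitive_shift_bounded qM' dQ).
move=> s _; have s0 := past_le0 s.
have h1 : Q (set_val s) <= 0 by have := primitive_le s0; rewrite Q0.
have : - T + set_val s <= - T by rewrite gerDl.
move/(primitive_lipschitz qM' dQ).
rewrite opprD addrA subrr sub0r (ler0_norm s0) ler_norml => /andP[_]; lra.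
Qed.
End DelayedBound.

(** Component [i] of the operator [D] on the history of [X - Y] at time [t]. *)
Definition neutral_diff (R : realType) (m : nat) (nu : 'I_m -> 'I_m -> pastMeasure R)
    (X Y : 'I_m -> R -> R) (i : 'I_m) (t : R) : R :=
  (X i t - Y i t) - \sum_j \int[nu i j]_s (X j (t + set_val s) - Y j (t + set_val s)).

Section Budget.
Context {R : realType} {m : nat}.
Variables (g : 'I_m.+1 -> 'I_m -> R -> R -> R) (mu nu : 'I_m -> 'I_m -> pastMeasure R).
Hypothesis admg : forall i j, C1_admissible (g i j).
Hypothesis mong : forall i j t, nondecreasing_fun (g i j t).
Hypothesis hmu : transit_hyp mu.
Hypothesis heta : eta_hyp mu nu g.
Variables (X Y : 'I_m -> R -> R) (B : R).
Hypotheses (cX : forall j, continuous (X j)) (cY : forall j, continuous (Y j))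
  (bX : forall j t, `|X j t| <= B) (bY : forall j t, `|Y j t| <= B).

Lemma neutral_diffC i t : neutral_diff nu Y X i t = - neutral_diff nu X Y i t.
Proof.
have -> : neutral_diff nu Y X i t = (Y i t - X i t)
    - \sum_j - \int[nu i j]_s (X j (t + set_val s) - Y j (t + set_val s)).
  congr (_ - _); apply: eq_bigr => j _.
  rewrite -(@Rintegral_pastN _ _ _ (B + B)).
  - by apply: eq_Rintegral => s _; rewrite opprB.
  - apply: (@continuous_shift_past _ (fun x => X j x - Y j x)) => x.
    by apply: cvgB; [exact: cX|exact: cY].
  - by move=> s; rewrite (le_trans (ler_normB _ _))// lerD.
by rewrite sumrN /neutral_diff; ring.
Qed.

Hypothesis dh : forall (i : 'I_m) (t : R), t <= 0 ->
  is_derive t (1 : R) (neutral_diff nu X Y i)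
  (- (\sum_k gap g X Y k i t)
    + \sum_j \int[mu i j]_s gap g X Y (cmpt i) j (t + set_val s)).

Lemma neutral_diff_bounded : exists C, forall i t, `|neutral_diff nu X Y i t| <= C.
Proof.
exists (B + B + \sum_i \sum_j (B + B) * fine (nu i j setT)) => i t.
have bw j u : `|X j u - Y j u| <= B + B by rewrite (le_trans (ler_normB _ _))// lerD.
rewrite /neutral_diff; apply: le_trans (ler_normB _ _) _; apply: lerD => //.
rewrite (le_trans (ler_norm_sum _ _ _))//.
rewrite [leRHS](bigD1 i)//= -[leLHS]addr0 lerD//.
  apply: ler_sum => j _; apply: Rintegral_past_le => // s.
  apply: (@continuous_shift_past _ (fun x => X j x - Y j x)) => x.
  by apply: cvgB; [exact: cX|exact: cY].
have B0 : 0 <= B by exact: le_trans (normr_ge0 _) (bX i 0).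
by apply: sumr_ge0 => k _; apply: sumr_ge0 => j _; rewrite mulr_ge0 ?addr_ge0 ?fine_ge0.
Qed.

(** As [Q i j 0 = 0], the quantity [- Q i j (- T)] is the mismatch integrated over [[- T, 0]]. The
    last clause integrates the quasimonotone estimate over that interval; its error [C] collects the
    bound on [neutral_diff] and the cost of the delays. *)
Lemma gap_budget : exists Q : 'I_m.+1 -> 'I_m -> R -> R, exists C : R,
  [/\ forall i j, Q i j 0 = 0,
      forall i j t, is_derive t (1 : R) (Q i j) `|gap g X Y i j t| &
      forall i T, 0 <= T ->
        \sum_k - Q k i (- T) <= \sum_j - Q (cmpt i) j (- T) + C].
Proof.
have cq i j : continuous (fun t => `|gap g X Y i j t| : R).
  by move=> t; apply: cvg_norm; exact: gap_continuous.
have /choice[Q' HQ] (ij : 'I_m.+1 * 'I_m) : exists Q : R -> R, Q 0 = 0 /\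
    forall t, is_derive t (1 : R) Q `|gap g X Y ij.1 ij.2 t|.
  by have [Q] := continuous_antiderivative (cq ij.1 ij.2); exists Q.
pose Q i j := Q' (i, j).
have Q0 i j : Q i j 0 = 0 by case: (HQ (i, j)).
have dQ i j t : is_derive t (1 : R) (Q i j) `|gap g X Y i j t| by case: (HQ (i, j)).
have /choice[M' HM] (ij : 'I_m.+1 * 'I_m) : exists M, 0 < M /\
    forall t, `|gap g X Y ij.1 ij.2 t| <= M.
  by have [M] := gap_bounded admg mong ij.1 (bX ij.2) (bY ij.2); exists M.
pose M i j := M' (i, j).
have qM i j t : `|gap g X Y i j t| <= M i j by case: (HM (i, j)).
have [C HC] := neutral_diff_bounded.
exists Q, (C + \sum_i \sum_j M (cmpt i) j * \int[mu i j]_s `|set_val s|).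
split=> // i T T0.
pose P j := delayed_primitive (mu i j) (Q (cmpt i) j).
have dP j t : is_derive t (1 : R) (P j)
    (\int[mu i j]_s `|gap g X Y (cmpt i) j (t + set_val s)|).
  apply: (@is_derive_delayed_primitive _ _
    (fun t => `|gap g X Y (cmpt i) j t|) _ (M (cmpt i) j)) => // u.
  by rewrite normr_id.
(* [K] is a primitive of outgoing minus delayed incoming mismatch, so the estimate says exactly that
   [|neutral_diff| + K] does not increase. *)
pose K t := \sum_k Q k i t - \sum_j P j t.
pose k' t := \sum_k `|gap g X Y k i t|
  - \sum_j \int[mu i j]_s `|gap g X Y (cmpt i) j (t + set_val s)|.
have dK t : is_derive t (1 : R) K (k' t).
  rewrite /K /k'.
  have := fun k => dQ k i t; have := fun j => dP j t => dPt dQt.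
  have -> : (fun t => \sum_k Q k i t - \sum_j P j t) =
            (\sum_k Q k i) - (\sum_j P j).
    by apply/funext => u; rewrite /= !fct_sumE.
  by apply: is_deriveB; apply: is_derive_sum.
have T0' : - T <= 0 by rewrite oppr_le0.
have := @normr_add_le_of_is_derive R (neutral_diff nu X Y i) K _ k' (- T) 0 T0' _ _ _ _.
move=> /(_ _ (fun t ht => dh i (proj2 (andP ht)))) /(_ (fun t _ => dK t)) main.
have {}main : `|neutral_diff nu X Y i 0| + K 0 <= `|neutral_diff nu X Y i (- T)| + K (- T).
  apply: main => t /andP[_ t0] h0.
    have := neutral_gap_le admg mong heta cX cY bX bY h0; rewrite /k'; lra.
  (* For nonpositive [neutral_diff] the two orbits are exchanged: signed gaps change sign, their
     absolute values do not. *)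
  have h0' : 0 <= neutral_diff nu Y X i t by rewrite neutral_diffC oppr_ge0.
  have := neutral_gap_le admg mong heta cY cX bY bX h0'.
  have -> : \sum_k gap g Y X k i t = - \sum_k gap g X Y k i t.
    by rewrite -sumrN; apply: eq_bigr => k _; rewrite gapC.
  have -> : \sum_k `|gap g Y X k i t| = \sum_k `|gap g X Y k i t|.
    by apply: eq_bigr => k _; rewrite gapC normrN.
  have -> : \sum_j \int[mu i j]_s gap g Y X (cmpt i) j (t + set_val s) =
      - \sum_j \int[mu i j]_s gap g X Y (cmpt i) j (t + set_val s).
    rewrite -sumrN; apply: eq_bigr => j _.
    rewrite -(@Rintegral_pastN _ _ _ (M (cmpt i) j)) => [|  |s].
    - by apply: eq_Rintegral => s _; rewrite gapC.
    - by apply: continuous_shift_past; exact: gap_continuous.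
    - exact: qM.
  have -> : \sum_j \int[mu i j]_s `|gap g Y X (cmpt i) j (t + set_val s)| =
      \sum_j \int[mu i j]_s `|gap g X Y (cmpt i) j (t + set_val s)|.
    by apply: eq_bigr => j _; apply: eq_Rintegral => s _; rewrite gapC normrN.
  rewrite /k'; lra.
have K0 : K 0 = 0.
  rewrite /K big1// ?sub0r ?big1 ?oppr0// => j _.
  rewrite /P /delayed_primitive.
  by under eq_Rintegral do rewrite add0r subrr; rewrite Rintegral_cst// mul0r.
have PT : - \sum_j P j (- T) <= \sum_j - Q (cmpt i) j (- T)
     + \sum_j M (cmpt i) j * \int[mu i j]_s `|set_val s|.
  rewrite -sumrN -big_split/=; apply: ler_sum => j _.
  have [mu1 mom] := hmu i j.
  have := delayed_primitive_ge (fun=> normr_ge0 _) (qM (cmpt i) j) (dQ _ _)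
    (Q0 _ _) mu1 mom T0.
  by rewrite /P; lra.
have Mi : \sum_j M (cmpt i) j * \int[mu i j]_s `|set_val s| <=
   \sum_i \sum_j M (cmpt i) j * \int[mu i j]_s `|set_val s|.
  rewrite [leRHS](bigD1 i)//= -[leLHS]addr0 lerD//.
  apply: sumr_ge0 => k _; apply: sumr_ge0 => j _; rewrite mulr_ge0//.
    by case: (HM (cmpt k, j)) => /ltW.
  by apply: Rintegral_ge0 => s _.
move: main; rewrite K0 /K sumrN.
have := HC i (- T); have := normr_ge0 (neutral_diff nu X Y i 0).
lra.
Qed.
End Budget.

(** * Continuity on the hull *)

Section HullTopology.
Context {R : realType} {m : nat}.
Local Notation ratefun := (@ratefun R m).

Lemma ratefun_eval_nbhs (w : ratefun) (p : R * R) (E : set (rates * rates)) :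
  entourage E -> \forall w' \near w, E (w p, w' p).
Proof.
move=> entE; have := fam_nbhs w entE (@compact_set1 _ p).
by apply: filterS => w' /(_ p); apply.
Qed.

Lemma ratefun_hausdorff : hausdorff_space ratefun.
Proof.
move=> w1 w2 cl; apply/funext => p.
have hr : hausdorff_space (@rates R m) by exact: norm_hausdorff.
apply: hr => A B; rewrite -!nbhs_entourageE => -[E1 entE1 E1A] [E2 entE2 E2B].
have [w [H1 H2]] := cl _ _ (ratefun_eval_nbhs w1 p entE1) (ratefun_eval_nbhs w2 p entE2).
by exists (w p); split; [apply: E1A|apply: E2B]; apply/xsectionP.
Qed.

Lemma translate_continuous t : continuous (translate^~ t : ratefun -> ratefun).
Proof.
move=> w.
have FF := @fmap_filter _ _ (translate^~ t) _ (nbhs_filter w).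
apply/(@fam_cvgP _ _ compact (translate^~ t @ w) (translate w t) FF) => K cK P.
move=> /uniform_nbhs[E [entE sub]].
pose sh (p : R * R) : R * R := (t + p.1, p.2).
have csh : continuous sh.
  move=> p; have c1 : t + q.1 @[q --> p] --> t + p.1.
    by apply: cvgD; [exact: cvg_cst|exact: cvg_fst].
  exact: (cvg_pair c1 (@cvg_snd _ _ (nbhs p.1) (nbhs p.2) _)).
have cK' : compact (sh @` K).
  by apply: continuous_compact => //; exact: continuous_subspaceT.
have := fam_nbhs w entE cK'; apply: filterS => w' H; apply: sub => p Kp.
by apply: (H (sh p)); exists p.
Qed.

Lemma translateD (w : ratefun) s t : translate (translate w s) t = translate w (s + t).
Proof. by apply/funext => p; rewrite /translate /= addrA. Qed.

Lemma translate0 (w : ratefun) : translate w 0 = w.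
Proof. by apply/funext => -[s v]; rewrite /translate /= add0r. Qed.

Lemma compact_open_eval_nbhs (f : {compact-open, past R -> 'rV[R]_m})
    (s : past R) (U : set 'rV[R]_m) :
  open U -> U (f s) -> \forall h \near f, U (h s).
Proof.
move=> oU Uf.
have [H _] := @compact_open_cvgP _ _ (nbhs f) f (nbhs_filter f).
have := H (fun A => id) [set s] U (@compact_set1 _ s) oU.
move=> /(_ _)/wrap[_ [_ ->] <-//|].
by apply: filterS => h; apply; exists s.
Qed.

(** A section with compact graph is continuous. If bad points accumulated at [w], their graph points
    would cluster in the compact graph; the base of a cluster point is [w] because the hull is
    Hausdorff, so the cluster point is [(w, x w)], where [U] already holds nearby. *)
Lemma compact_graph_near (Omega : set ratefun) (x : ratefun -> past R -> 'rV[R]_m)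
    (w : ratefun) (s : past R) (U : set 'rV[R]_m) :
  compact (graph_over Omega x : set (@phase R m)) -> Omega w -> open U -> U (x w s) ->
  \forall w' \near w, Omega w' -> U (x w' s).
Proof.
move=> cG Ow oU Uxw; apply: contrapT => nU.
pose bad := [set w' | Omega w' /\ ~ U (x w' s)].
pose F := (fun w' => (w', x w') : @phase R m) @ within bad (nbhs w).
have PF : ProperFilter F.
  have PW : ProperFilter (within bad (nbhs w)).
    apply: Build_ProperFilter => H; apply: nU.
    apply: (@filterS _ (nbhs w) (nbhs_filter w) _ _ _ H) => w' nbad Ow'.
    by apply: contrapT => nUw'; exact: nbad.
  exact: fmap_proper_filter.
have FG : F (graph_over Omega x).
  by apply: (@filterE _ (nbhs w) (nbhs_filter w)) => w' [Ow' _]; exists w'.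
have [p [[w1 Ow1 <-{p}] cl]] := cG F PF FG.
have w1E : w1 = w.
  apply: ratefun_hausdorff => A1 A2 nA1 nA2.
  have FA2 : F (fst @^-1` A2).
    by apply: filterS nA2 => w' ? _.
  have nA1' : nbhs ((w1, x w1) : @phase R m) (fst @^-1` A1).
    exact: (@cvg_fst _ _ (nbhs w1) (nbhs (x w1 : {compact-open, past R -> 'rV[R]_m})) _ _ nA1).
  have [[w2 ?] [/= A2w A1w]] := cl _ _ FA2 nA1'.
  by exists w2.
rewrite w1E in cl.
have FU : F [set p | ~ U (p.2 s)] by apply: (@filterE _ (nbhs w) (nbhs_filter w)) => w' [].
have nU' : nbhs ((w, x w) : @phase R m) [set p | U (p.2 s)].
  have := compact_open_eval_nbhs oU Uxw.
  exact: (@cvg_snd _ _ (nbhs w) (nbhs (x w : {compact-open, past R -> 'rV[R]_m})) _ _).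
by have [p [/=]] := cl _ _ FU nU'.
Qed.
End HullTopology.

(** * Rigidity from minimality of the hull *)

Section HullRigidity.
Context {R : realType} {m : nat}.
Local Notation ratefun := (@ratefun R m).
Variables (Omega : set ratefun) (x y : ratefun -> past R -> 'rV[R]_m).
Hypotheses (minO : flow_minimal Omega) (closedO : closed Omega)
  (cx : compact (graph_over Omega x : set (@phase R m)))
  (cy : compact (graph_over Omega y : set (@phase R m))).

Lemma graph_coord_near (z : ratefun -> past R -> 'rV[R]_m) w s (j : 'I_m) (e : R) :
  compact (graph_over Omega z : set (@phase R m)) -> Omega w -> 0 < e ->
  \forall w' \near w, Omega w' ->
    `|z (translate w s) (past0 R) 0 j - z (translate w' s) (past0 R) 0 j| < e.
Proof.
move=> cz Ow e0; have [_ _ trO _] := minO.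
pose a := z (translate w s) (past0 R) 0 j.
pose U := [set v : 'rV[R]_m | `|a - v 0 j| < e].
have oU : open U.
  have /continuousP H : continuous (fun v : 'rV[R]_m => v 0 j) by exact: coord_continuous.
  have := H _ (@ball_open _ R^o a e).
  by congr (open _); apply/seteqP; split.
have Ua : U (z (translate w s) (past0 R)) by rewrite /U /= /a subrr normr0.
have := compact_graph_near cz (trO _ s Ow) oU Ua.
move=> /(@translate_continuous R m s w).
apply: (@filterS _ (nbhs w) (nbhs_filter w)) => w' H Ow'.
by apply: H; exact: trO.
Qed.

Lemma graph_diff_near w s (j : 'I_m) :
  Omega w -> x (translate w s) (past0 R) 0 j <> y (translate w s) (past0 R) 0 j ->
  exists2 e, 0 < e & \forall w' \near w, Omega w' ->
    e < `|x (translate w' s) (past0 R) 0 j - y (translate w' s) (past0 R) 0 j|.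
Proof.
move=> Ow /eqP; rewrite -subr_eq0 -normr_gt0 => d0.
(* Moving [x] and [y] by less than a third of their distance leaves more than a third. *)
set d := `|_| in d0; exists (d / 3); first by rewrite divr_gt0.
have d3 : 0 < d / 3 by rewrite divr_gt0.
have := graph_coord_near s j cx Ow d3; have := graph_coord_near s j cy Ow d3.
apply: (@filterS2 _ (nbhs w) (nbhs_filter w)) => w' Hy Hx Ow'.
move: (Hx Ow') (Hy Ow'); rewrite -/d => hx hy.
move: d0 hx hy; rewrite /d.
set a := x (translate w s) _ 0 j; set b := x (translate w' s) _ 0 j.
set a' := y (translate w s) _ 0 j; set b' := y (translate w' s) _ 0 j => d0 hx hy.
have : `|a - a'| <= `|a - b| + `|b - b'| + `|a' - b'|.
  have -> : a - a' = (a - b) + (b - b') - (a' - b') by ring.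
  by rewrite (le_trans (ler_normB _ _))// lerD2r ler_normD.
lra.
Qed.

Hypotheses
  (x_orbit : forall w, Omega w -> forall s : past R,
    x w s = x (translate w (set_val s)) (past0 R))
  (y_orbit : forall w, Omega w -> forall s : past R,
    y w s = y (translate w (set_val s)) (past0 R)).

(** The hull points along whose whole orbit the components agree form a closed invariant set [N].
    Decay at minus infinity makes [N] nonempty, so minimality gives [N = Omega]. *)
Lemma component_eq_of_decay (w0 : ratefun) (j : 'I_m) : Omega w0 ->
  (forall e : R, 0 < e -> exists T : R, forall t, t <= T ->
    `|x (translate w0 t) (past0 R) 0 j - y (translate w0 t) (past0 R) 0 j| <= e) ->
  forall w, Omega w -> forall s, x w s 0 j = y w s 0 j.
Proof.
move=> Ow0 decay; have [_ cO trO minimal] := minO.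
pose N := [set w | Omega w /\ forall s : R,
  x (translate w s) (past0 R) 0 j = y (translate w s) (past0 R) 0 j].
suff NO : N = Omega.
  move=> w Ow s; rewrite x_orbit// y_orbit//.
  by have [_] : N w by rewrite NO.
apply: minimal.
(* Any limit point of the orbit of [w0] at minus infinity lies in [N]: a disagreement there would
   persist, with a positive margin, at arbitrarily early times. *)
- pose F := translate w0 @ -oo%R.
  have PF : ProperFilter F by exact: fmap_proper_filter.
  have FO : F Omega by exists 0; split => // t _; exact: trO.
  have [w [Ow cl]] := cO F PF FO.
  exists w; split => // s; apply: contrapT => xy.
  have [e e0 near_w] := graph_diff_near Ow xy.
  have [T HT] := decay e e0.
  have FT : F [set w' | exists2 t, t <= T - s & w' = translate w0 t].
    exists (T - s); split; first exact: num_real.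
    by move=> t tT; exists t => //; exact: ltW.
  have [w' [[t tT ->] H]] := cl _ _ FT near_w.
  have := H (trO _ _ Ow0); rewrite translateD ltNge => /negP; apply.
  by apply: HT; lra.
- move=> w clw.
  have Ow : Omega w.
    by apply: closedO; apply: closureS clw => w' [].
  split => // s; apply: contrapT => xy.
  have [e e0 near_w] := graph_diff_near Ow xy.
  have [w' [[Ow' Nw'] H]] := clw _ near_w.
  by have := H Ow'; rewrite Nw' subrr normr0 ltNge (ltW e0).
- by move=> w t [Ow Nw]; split=> [|s]; [exact: trO|rewrite translateD].
- by move=> w [].
Qed.
End HullRigidity.

(** * Orbits over the hull *)

(** Let [m0] be the infimum over all components and all times up to [t0]. If [m0 < 0], the
    hypothesis bounds every value below by [lam * m0], where [lam < 1] is the largest row mass of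
    [nu]; hence [lam * m0 <= m0], which is absurd. *)
Lemma neutral_nonneg (R : realType) (m : nat) (nu : 'I_m -> 'I_m -> pastMeasure R)
    (X : 'I_m -> R -> R) (B t0 : R) :
  (forall i, (\sum_j nu i j setT < 1)%E) ->
  (forall j, continuous (X j)) -> (forall j t, `|X j t| <= B) ->
  (forall t i, t <= t0 -> 0 <= X i t - \sum_j \int[nu i j]_s X j (t + set_val s)) ->
  forall t i, t <= t0 -> 0 <= X i t.
Proof.
move=> nu1 cX bX DX t i tt0; rewrite leNgt; apply/negP => Xneg.
pose c k := \sum_j fine (nu k j setT).
have c0 k : 0 <= c k by apply: sumr_ge0 => j _; rewrite fine_ge0.
have c1 k : c k < 1.
  rewrite -lte_fin /c -sumEFin; under eq_bigr do rewrite fineK ?fin_num_measure//.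
  exact: nu1.
pose lam := \big[Num.max/0]_k c k.
have lam1 : lam < 1 by apply/bigmax_ltP; split.
have lamc k : c k <= lam by exact: le_bigmax.
have lam0 : 0 <= lam by exact: bigmax_ge_id.
pose S := [set X k u | k in [set: 'I_m] & u in [set u | u <= t0]].
have St : S (X i t) by exists i => //; exists t.
have infS : has_inf S.
  split; first by exists (X i t).
  by exists (- B) => _ [k _ [u _ <-]]; have := bX k u; rewrite ler_norml => /andP[].
pose m0 := inf S.
have m0lb k u : u <= t0 -> m0 <= X k u.
  by move=> ut; apply: ge_inf; [exact: infS.2|exists k => //; exists u].
have m0neg : m0 < 0 by exact: le_lt_trans (m0lb i t tt0) Xneg.
have step k u : u <= t0 -> lam * m0 <= X k u.
  move=> ut; have := DX u k ut; rewrite subr_ge0; apply: le_trans.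
  apply: (@le_trans _ _ (c k * m0)); first by rewrite ler_nM2r.
  rewrite mulr_suml; apply: ler_sum => j _.
  rewrite mulrC -[leLHS](Rintegral_cst (nu k j) measurableT); apply: le_Rintegral => //.
  - by apply: (@integrable_past _ _ _ `|m0|) => // s; exact: cst_continuous.
  - apply: (@integrable_past _ _ _ B) => //; exact: continuous_shift_past.
  - by move=> s _; apply: m0lb; have := past_le0 s; lra.
have : lam * m0 <= m0.
  by apply: lb_le_inf; [exists (X i t)|move=> _ [k _ [u ut <-]]; exact: step].
by move=> le_m0; move: lam1 m0neg le_m0; clear; nra.
Qed.

Lemma is_derive_of_deriv_on_nneg (R : realType) (f : R -> R) (t l : R) :
  0 < t -> deriv_on_nneg f t l -> is_derive t (1 : R) f l.
Proof.
move=> t0 H.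
have H' : h^-1 *: (f (h *: 1 + t) - f t) @[h --> 0^'] --> l.
  apply/cvgrPdist_lt => e e0.
  move: H => /cvgrPdist_lt/(_ e e0); rewrite near_withinE => H1.
  near=> h.
  have th : 0 <= t + h.
    near: h; apply: nbhs_dnbhs; near=> h.
    have : `|0 - h| < t by near: h; exact: (@nbhsx_ballx _ R^o).
    by rewrite sub0r normrN ltr_norml => /andP[]; lra.
  have : 0 <= t + h -> `|l - h^-1 * (f (t + h) - f t)| < e.
    by near: h; exact: H1.
  move=> /(_ th); by rewrite [_ *: 1]mulr1 [h + t]addrC.
apply: DeriveDef; first by apply/cvg_ex; exists l.
exact/cvg_lim.
Unshelve. all: by end_near. Qed.

Section Orbit.
Context {R : realType} {m : nat}.
Local Notation ratefun := (@ratefun R m).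
Variables (mu nu : 'I_m -> 'I_m -> pastMeasure R) (Omega : set ratefun)
  (x : ratefun -> past R -> 'rV[R]_m).
Hypotheses (trO : translation_invariant Omega)
  (invx : positively_invariant mu nu (graph_over Omega x : set (@phase R m))).

Lemma graph_solution w : Omega w -> exists2 z, family_solution mu nu w (x w) z &
  forall t, 0 <= t -> history z t = x (translate w t).
Proof.
move=> Ow; have [|z sz inv] := invx (w := w) (x := x w); first by exists w.
by exists z => // t /inv [w' _ [<- <-]].
Qed.

(** Start on the graph at [translate w s] and run forward for time [- s]: invariance returns to
    [x w], whose value at [s] is the initial value of that solution. *)
Lemma graph_orbit w (s : past R) : Omega w ->
  x w s = x (translate w (set_val s)) (past0 R).
Proof.
move=> Ow; have s0 := past_le0 s.
have [z _ H] := graph_solution (trO (set_val s) Ow).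
have ns0 : 0 <= - set_val s by rewrite oppr_ge0.
have := H _ ns0; rewrite translateD subrr translate0 => <-.
have := H 0 (lexx 0); rewrite translate0 => <-.
by rewrite /history /= addNr addr0.
Qed.

Lemma solution_orbit_all w z : Omega w -> family_solution mu nu w (x w) z ->
  (forall t, 0 <= t -> history z t = x (translate w t)) ->
  forall t, z t = x (translate w t) (past0 R).
Proof.
move=> Ow [_ z0 _] H t; have [t0|t0] := lerP 0 t.
  by rewrite -H// /history /= addr0.
have tp : t \in (`]-oo, 0]%classic : set R) by rewrite inE /= in_itv /= ltW.
have := graph_orbit (exist _ t tp) Ow; rewrite /= => <-.
by rewrite -z0 /history /= add0r.
Qed.
End Orbit.

Section BaseOrbit.
Context {R : realType} {m : nat}.
Local Notation ratefun := (@ratefun R m).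
Variables (g : 'I_m.+1 -> 'I_m -> R -> R -> R) (inflow : 'I_m -> R -> R).
Variables (mu nu : 'I_m -> 'I_m -> pastMeasure R).
Local Notation base := (bundle g inflow).
Local Notation Omega := (hull base).
Variable x : ratefun -> past R -> 'rV[R]_m.
Hypotheses (trO : translation_invariant Omega)
  (invx : positively_invariant mu nu (graph_over Omega x : set (@phase R m))).

Lemma hull_base : Omega base.
Proof. by apply: subset_closure; exists 0 => //; rewrite translate0. Qed.

Lemma pipe_translate i j t v : pipe i j (translate base t) v = g i j t v.
Proof. by rewrite /pipe /translate /bundle /= mxE addr0. Qed.

Lemma env_inflow_translate i t : env_inflow i (translate base t) = inflow i t.
Proof. by rewrite /env_inflow /translate /bundle /= mxE addr0. Qed.

Definition base_orbit (i : 'I_m) (t : R) : R := x (translate base t) (past0 R) 0 i.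

Definition base_orbit_rhs (X : 'I_m -> R -> R) (i : 'I_m) (t : R) : R :=
  - (\sum_k g k i t (X i t))
  + \sum_j \int[mu i j]_s g (cmpt i) j (t + set_val s) (X j (t + set_val s))
  + inflow i t.

(** Starting the forward solution at time [t - 1] turns [t] into its interior time 1, where the
    one-sided derivative is two-sided. *)
Lemma base_orbit_is_derive i t : is_derive t (1 : R)
  (fun u => base_orbit i u - \sum_j \int[nu i j]_s base_orbit j (u + set_val s))
  (base_orbit_rhs base_orbit i t).
Proof.
have Ot := @trO _ (t - 1) hull_base.
have [z sz H] := graph_solution invx Ot.
have zE u : z u = x (translate base (t - 1 + u)) (past0 R).
  by rewrite (solution_orbit_all trO invx Ot sz H) translateD.
have [_ _ /(_ 1 i ler01)] := sz.
move=> /(is_derive_of_deriv_on_nneg ltr01) dz.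
have dz' : is_derive (t + (1 - t)) (1 : R) (fun u : R => D nu (history z u) 0 i)
   (F mu (translate (translate base (t - 1)) 1) (history z 1) 0 i).
  by rewrite addrC subrK.
have := @is_derive_comp_addr _ _ _ _ _ dz'.
have -> : (fun u => D nu (history z (u + (1 - t))) 0 i) =
   (fun u => base_orbit i u - \sum_j \int[nu i j]_s base_orbit j (u + set_val s)).
  apply/funext => u; rewrite mxE /history /= zE addr0; congr (_ - _).
    by rewrite /base_orbit; congr (x (translate _ _) _ _ _); ring.
  apply: eq_bigr => j _; apply: eq_Rintegral => s _; rewrite zE.
  by rewrite /base_orbit; congr (x (translate _ _) _ _ _); ring.
congr (is_derive _ _ _ _).
rewrite translateD subrK mxE /history /= addr0 zE subrK /base_orbit_rhs env_inflow_translate.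
congr (_ + _ + _).
  rewrite big_ord_recl opprD pipe_translate; congr (_ - _).
  by apply: eq_bigr => j _; rewrite pipe_translate.
apply: eq_bigr => j _; apply: eq_Rintegral => s _.
rewrite translateD pipe_translate zE /base_orbit.
by congr (g _ _ _ (x (translate _ _) _ _ _)); ring.
Qed.
End BaseOrbit.

(** * Orbits frozen after time 1 *)

Lemma to_past_subproof (R : realType) (t : R) :
  Num.min t 0 \in (`]-oo, 0]%classic : set R).
Proof. by rewrite inE /= in_itv /= ge_min lexx orbT. Qed.

(** The 1-Lipschitz retraction of the line onto the past; composing with it preserves boundedness
    and uniform continuity. *)
Definition to_past (R : realType) (t : R) : past R :=
  exist _ (Num.min t 0) (to_past_subproof t).

Lemma to_past_val (R : realType) (t : R) : t <= 0 -> set_val (to_past t) = t.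
Proof. by move=> t0; apply: min_l. Qed.

Lemma to_past_nneg (R : realType) (t : R) : 0 <= t -> to_past t = past0 R.
Proof. by move=> t0; apply/val_inj; apply: min_r. Qed.

Lemma dist_min0 (R : realType) (a b : R) : `|Num.min a 0 - Num.min b 0| <= `|a - b|.
Proof.
have [a0|a0] := lerP a 0; have [b0|b0] := lerP b 0; rewrite ?subrr ?subr0 ?sub0r ?normr0//.
  by rewrite !ler0_norm; lra.
by rewrite normrN (ler0_norm b0) ger0_norm; lra.
Qed.

Lemma coord_le_norm (R : realType) (m : nat) (v : 'rV[R]_m) i : `|v 0 i| <= `|v|.
Proof.
rewrite [leRHS]mx_normrE.
exact: (le_bigmax _ (fun ij => `|v ij.1 ij.2|) (0, i)).
Qed.

Section FrozenOrbit.
Context {R : realType} {m : nat}.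
Local Notation ratefun := (@ratefun R m).
Variables (g : 'I_m.+1 -> 'I_m -> R -> R -> R) (inflow : 'I_m -> R -> R).
Variables (mu nu : 'I_m -> 'I_m -> pastMeasure R).
Local Notation base := (bundle g inflow).
Local Notation Omega := (hull base).
Variable x : ratefun -> past R -> 'rV[R]_m.
Hypotheses (trO : translation_invariant Omega)
  (invx : positively_invariant mu nu (graph_over Omega x : set (@phase R m)))
  (nu1 : forall i, (\sum_j nu i j setT < 1)%E)
  (posx : graph_over Omega x `<=` Omega `*` BUDpos nu).

(* Freezing the orbit at time 1 makes it bounded and uniformly continuous on
   the whole line without disturbing the equation at nonpositive times. *)
Definition frozen (i : 'I_m) (t : R) : R := x (translate base 1) (to_past (t - 1)) 0 i.

Lemma frozen_orbit i t : t <= 1 -> frozen i t = base_orbit g inflow x i t.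
Proof.
move=> t1; rewrite /frozen (graph_orbit trO invx) ?translateD; last first.
  by apply: trO; exact: hull_base.
rewrite to_past_val ?subr_le0// /base_orbit; congr (x (translate _ _) _ _ _); ring.
Qed.

Lemma BUDpos1 : BUDpos nu (x (translate base 1)).
Proof.
have Ow : Omega (translate base 1) by apply: trO; exact: hull_base.
by have [] := posx (ex_intro2 _ _ _ Ow erefl).
Qed.

Lemma frozen_bounded : exists B, forall i t, `|frozen i t| <= B.
Proof.
have [[bx _] _] := BUDpos1; have [B _ HB] := bounded_funP_ex bx.
by exists B => i t; apply: le_trans (HB (to_past (t - 1))); exact: coord_le_norm.
Qed.

Lemma frozen_unif_continuous (e : R) : 0 < e -> exists2 d, 0 < d &
  forall i t u, `|t - u| < d -> `|frozen i t - frozen i u| < e.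
Proof.
move=> e0; have [[_ ux] _] := BUDpos1.
have := ux [set p | ball p.1 e p.2] _; rewrite nbhs_simpl /=.
have entE : entourage [set p : 'rV[R]_m * 'rV[R]_m | ball p.1 e p.2].
  by rewrite -entourage_ballE; exists e.
move=> /(_ entE); rewrite -entourage_ballE => -[d /= d0 dP].
exists d => // i t u tu.
have := dP (to_past (t - 1), to_past (u - 1)).
move=> /(_ _)/wrap[|].
  rewrite /= -initial_ballE /= /ball /= (le_lt_trans (dist_min0 _ _))//.
  by have -> : t - 1 - (u - 1) = t - u by ring.
rewrite /= -ball_normE /= => /(le_lt_trans (coord_le_norm _ i)).
by rewrite !mxE.
Qed.

Lemma frozen_continuous i : continuous (frozen i).
Proof.
move=> t; apply/cvgrPdist_lt => e e0.
have [d d0 dP] := frozen_unif_continuous e0.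
near=> u; apply: dP; near: u; exact: (@nbhsx_ballx _ R^o).
Unshelve. all: by end_near. Qed.

(** Membership in [BUDpos] only makes [D] of the shifted histories nonnegative; [neutral_nonneg]
    passes from [D] to the function itself up to time 1, after which the value is constant. *)
Lemma frozen_ge0 i t : 0 <= frozen i t.
Proof.
have le1 u : u <= 1 -> 0 <= frozen i u.
  have [B HB] := frozen_bounded.
  apply: (neutral_nonneg nu1 frozen_continuous HB) => {}u {}i u1.
  have [_ /(_ (to_past (u - 1)) i)] := BUDpos1.
  rewrite mxE; congr (_ <= _ - _).
    by rewrite /frozen /past_shift; congr (x _ _ _ _); apply/val_inj; apply: addr0.
  apply: eq_bigr => j _; apply: eq_Rintegral => s _; rewrite /frozen /past_shift.
  have s0 := past_le0 s; congr (x _ _ _ _); apply/val_inj.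
  transitivity (set_val (to_past (u - 1)) + set_val s) => //.
  rewrite to_past_val; last by lra.
  rewrite (_ : \val _ = set_val (to_past (u + set_val s - 1)))// to_past_val; lra.
have [t1|t1] := lerP t 1; first exact: le1.
have -> : frozen i t = frozen i 1; last exact: le1.
by rewrite /frozen !to_past_nneg; lra.
Qed.

Lemma frozen_is_derive i (t : R) : t <= 0 -> is_derive t (1 : R)
  (fun u => frozen i u - \sum_j \int[nu i j]_s frozen j (u + set_val s))
  (base_orbit_rhs g inflow mu frozen i t).
Proof.
move=> t0; have t1 : t < 1 by lra.
have := base_orbit_is_derive trO invx i t.
have -> : base_orbit_rhs g inflow mu (base_orbit g inflow x) i t =
    base_orbit_rhs g inflow mu frozen i t.
  rewrite /base_orbit_rhs frozen_orbit ?(ltW t1)//; congr (_ + _ + _).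
  apply: eq_bigr => j _; apply: eq_Rintegral => s _; rewrite frozen_orbit//.
  by have := past_le0 s; lra.
(* Freezing starts only at time 1, so a full neighbourhood of [t <= 0], together with its past,
   still sees the true orbit. *)
apply: near_eq_is_derive; near=> u.
have u1 : u <= 1 by apply: ltW; near: u; exact: lt_nbhsl.
rewrite frozen_orbit//; congr (_ - _).
apply: eq_bigr => j _; apply: eq_Rintegral => s _; rewrite frozen_orbit//.
by have := past_le0 s; lra.
Unshelve. all: by end_near. Qed.
End FrozenOrbit.

(** * Decay and flow conservation *)

Section Decay.
Context {R : realType} {m : nat}.
Variables (g : 'I_m.+1 -> 'I_m -> R -> R -> R) (X Y : 'I_m -> R -> R) (B : R).
Hypotheses (admg : forall i j, C1_admissible (g i j))
  (mong : forall i j t, nondecreasing_fun (g i j t)).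
Hypotheses (bX : forall j t, X j t <= B) (bY : forall j t, Y j t <= B)
  (X0 : forall j t, 0 <= X j t) (Y0 : forall j t, 0 <= Y j t)
  (uX : forall e : R, 0 < e -> exists2 d, 0 < d & forall i t u,
     `|t - u| < d -> `|X i t - X i u| < e)
  (uY : forall e : R, 0 < e -> exists2 d, 0 < d & forall i t u,
     `|t - u| < d -> `|Y i t - Y i u| < e).

(** If [|X j t - Y j t| > e], uniform continuity keeps the difference above [e / 2] during a time
    [r] before [t], and [rate_gap] makes the mismatch at least [rho] there. Each such [t] adds
    [rho * r] to a bounded monotone quantity, so they cannot occur arbitrarily early. *)
Lemma decay_of_bounded_flow i j (Q : R -> R) (C : R) :
  carries_material g i j ->
  (forall t, is_derive t (1 : R) Q `|gap g X Y i j t|) ->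
  (forall T, 0 <= T -> - Q (- T) <= C) ->
  forall e : R, 0 < e -> exists T : R, forall t, t <= T -> `|X j t - Y j t| <= e.
Proof.
move=> carr dQ QC e e0; apply: contrapT => nT.
have bad (T : R) : exists2 t, t <= T & e < `|X j t - Y j t|.
  apply: contrapT => nt; apply: nT; exists T => t tT; rewrite leNgt; apply/negP => et.
  by apply: nt; exists t.
have e4 : 0 < e / 4 by rewrite divr_gt0.
have e2 : 0 < e / 2 by rewrite divr_gt0.
have [d1 d10 H1] := uX e4; have [d2 d20 H2] := uY e4.
pose r := Num.min d1 d2 / 2.
have r0 : 0 < r by rewrite divr_gt0// lt_min d10.
have rd : r < d1 /\ r < d2.
  have rE : r + r = Num.min d1 d2 by rewrite /r; lra.
  have m1 : Num.min d1 d2 <= d1 by rewrite ge_min lexx.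
  have m2 : Num.min d1 d2 <= d2 by rewrite ge_min lexx orbT.
  by split; lra.
have [rho rho0 Hrho] := rate_gap (admg i j) (@mong i j) carr B e2.
have Qle a b : a <= b -> Q a <= Q b.
  by apply: (primitive_le _ dQ) => t; exact: normr_ge0.
have large t u : e < `|X j t - Y j t| -> t - r <= u <= t -> rho <= `|gap g X Y i j u|.
  move=> et /andP[tu ut].
  have /H1 - /(_ j) : `|t - u| < d1 by rewrite ger0_norm; lra.
  have /H2 - /(_ j) : `|t - u| < d2 by rewrite ger0_norm; lra.
  rewrite !ltr_norml => /andP[h1 h2] /andP[h3 h4].
  have [XY|XY] := lerP (Y j u) (X j u).
    apply: le_trans (ler_norm _); apply: Hrho; [exact: Y0|exact: bX|].
    by move: et; rewrite ltr_normr => /orP[|]; lra.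
  rewrite -normrN; apply: le_trans (ler_norm _); rewrite -gapC.
  apply: Hrho; [exact: X0|exact: bY|].
  by move: et; rewrite ltr_normr => /orP[|]; lra.
pose S := [set - Q (- T) | T in [set T | 0 <= T]].
have supS : has_sup S.
  split; first by exists (- Q (- 0)); exists 0 => //=.
  by exists C => _ [T T0 <-]; exact: QC.
(* Beyond this [T] less than [rho * r] of mismatch is left to accumulate. *)
have [_ [T T0 <-] QT] := sup_adherent (mulr_gt0 rho0 r0) supS.
have [t tT et] := bad (- T).
have tr : t - r < t by lra.
have cQ : {within `[t - r, t], continuous Q}.
  exact/continuous_subspaceT/(primitive_continuous dQ).
have [c ct QE] := MVT tr (fun x _ => dQ x) cQ.
have : rho * r <= Q t - Q (t - r).
  rewrite QE; have -> : t - (t - r) = r by ring.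
  rewrite ler_wpM2r ?(ltW r0)//; apply: large et _.
  by move: ct; rewrite in_itv/= => /andP[/ltW -> /ltW ->].
have : - Q (t - r) <= sup S.
  apply: sup_ubound; first exact: supS.2.
  by exists (r - t); rewrite /= ?opprB//; rewrite /= in T0; lra.
have := Qle _ _ tT; lra.
Qed.
End Decay.

Section Flow.
Context {R : realType} {m : nat}.
Variables (N : 'I_m.+1 -> 'I_m -> R) (C : R).
Hypotheses (N0 : forall i j, 0 <= N i j)
  (NC : forall i, \sum_k N k i <= \sum_j N (cmpt i) j + C).

Lemma flow_split i : \sum_k N k i = N ord0 i + \sum_l N (cmpt l) i.
Proof. by rewrite big_ord_recl. Qed.

(** In the sum over all compartments each internal pipe occurs once as outflow and once as inflow
    and cancels. All terms on the left are nonnegative, so each is at most [m%:R * C]. *)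
Lemma flow_total :
  \sum_i N ord0 i + \sum_i (\sum_j N (cmpt i) j + C - \sum_k N k i) = m%:R * C.
Proof.
rewrite -big_split/=.
under eq_bigr do rewrite flow_split.
rewrite (eq_bigr (fun i => \sum_j N (cmpt i) j - \sum_l N (cmpt l) i + C)); last first.
  by move=> i _; ring.
rewrite big_split/= sumrB [X in _ - X + _]exchange_big/= subrr add0r.
by rewrite sumr_const card_ord mulr_natl.
Qed.

Lemma flow_slack_ge0 i : 0 <= \sum_j N (cmpt i) j + C - \sum_k N k i.
Proof. by rewrite subr_ge0. Qed.

Lemma outflow_le i : N ord0 i <= m%:R * C.
Proof.
rewrite -flow_total (bigD1 i)//= -addrA lerDl addr_ge0//.
  by apply: sumr_ge0 => k _.
by apply: sumr_ge0 => k _; exact: flow_slack_ge0.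
Qed.

(** The converse of [NC]: the slack of one compartment is bounded by the total slack. *)
Lemma flow_in_le i : \sum_j N (cmpt i) j + C <= \sum_k N k i + m%:R * C.
Proof.
suff : \sum_j N (cmpt i) j + C - \sum_k N k i <= m%:R * C by rewrite lerBlDl.
rewrite -flow_total [X in _ <= _ + X](bigD1 i)//= addrCA lerDl addr_ge0//.
  by apply: sumr_ge0 => k _.
by apply: sumr_ge0 => k _; exact: flow_slack_ge0.
Qed.

(** Sum [flow_in_le] over [J]. Flows within [J] cancel, flows from [J] to other compartments vanish
    and those to the environment are bounded, which bounds everything entering [J] from outside. *)
Lemma flow_into_closed_le (J : {set 'I_m}) :
  (forall i l, i \in J -> l \notin J -> N (cmpt l) i = 0) ->
  forall i k, i \in J -> k \notin J ->
    N (cmpt i) k <= #|J|%:R * (m%:R * C + (m%:R * C - C)).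
Proof.
move=> closedJ i k iJ kJ.
pose inner i := \sum_(j in J) N (cmpt i) j.
pose outer i := \sum_(j | j \notin J) N (cmpt i) j.
have outer0 l : 0 <= outer l by apply: sumr_ge0 => j _.
have le_i l : l \in J ->
    inner l + outer l <= \sum_(p in J) N (cmpt p) l + (m%:R * C + (m%:R * C - C)).
  move=> lJ; have := flow_in_le l; rewrite flow_split.
  rewrite (bigID (mem J))/= -/(inner l) -/(outer l).
  rewrite (bigID (mem J) predT)/= [X in N _ _ + (_ + X)]big1; last first.
    by move=> p pJ; exact: closedJ.
  have := outflow_le l; lra.
have : \sum_(l in J) (inner l + outer l) <=
    \sum_(l in J) (\sum_(p in J) N (cmpt p) l + (m%:R * C + (m%:R * C - C))).
  exact: ler_sum.
rewrite [leLHS]big_split [leRHS]big_split/= [X in X + _ <= _]exchange_big/= lerD2l.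
rewrite sumr_const -[leRHS]mulr_natl.
apply: le_trans.
rewrite (bigD1 i)//= /outer (bigD1 k)//= -addrA lerDl addr_ge0//.
  by apply: sumr_ge0 => j _.
by apply: sumr_ge0 => l _; exact: outer0.
Qed.
End Flow.

(** * Comparison of two minimal sets *)

Section Comparison.
Context {R : realType} {m : nat}.
Local Notation ratefun := (@ratefun R m).
Variables (g : 'I_m.+1 -> 'I_m -> R -> R -> R) (inflow : 'I_m -> R -> R)
  (mu nu : 'I_m -> 'I_m -> pastMeasure R).
Local Notation Omega := (hull (bundle g inflow)).
Hypotheses (admg : forall i j, C1_admissible (g i j))
  (mong : forall i j t, nondecreasing_fun (g i j t))
  (hrec : flow_minimal Omega)
  (hmu : transit_hyp mu)
  (nu1 : forall i, (\sum_j nu i j setT < 1)%E)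
  (heta : eta_hyp mu nu g) (hpipe : pipe_hyp g).
Variables x y : ratefun -> past R -> 'rV[R]_m.
Hypotheses
  (cx : compact (graph_over Omega x : set (@phase R m)))
  (cy : compact (graph_over Omega y : set (@phase R m)))
  (ix : positively_invariant mu nu (graph_over Omega x : set (@phase R m)))
  (iy : positively_invariant mu nu (graph_over Omega y : set (@phase R m)))
  (px : graph_over Omega x `<=` Omega `*` BUDpos nu)
  (py : graph_over Omega y `<=` Omega `*` BUDpos nu).

Let trO : translation_invariant Omega. Proof. by case: hrec. Qed.
Let X := frozen g inflow x.
Let Y := frozen g inflow y.
Let cX i : continuous (X i) := frozen_continuous trO px (i := i).
Let cY i : continuous (Y i) := frozen_continuous trO py (i := i).
Let X0 i t : 0 <= X i t := frozen_ge0 trO nu1 px i t.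
Let Y0 i t : 0 <= Y i t := frozen_ge0 trO nu1 py i t.

Definition coincide (j : 'I_m) : Prop :=
  forall w, Omega w -> forall s, x w s 0 j = y w s 0 j.

Let bXY : exists B, (forall i t, `|X i t| <= B) /\ (forall i t, `|Y i t| <= B).
Proof.
have [B1 H1] := frozen_bounded trO px; have [B2 H2] := frozen_bounded trO py.
exists (Num.max B1 B2); split=> i t; rewrite le_max ?H1// H2 orbT//.
Qed.

(** The difference of the two equations; the inflow from the environment cancels. *)
Lemma neutral_diff_is_derive (i : 'I_m) (t : R) : t <= 0 ->
  is_derive t (1 : R) (neutral_diff nu X Y i)
    (- (\sum_k gap g X Y k i t)
      + \sum_j \int[mu i j]_s gap g X Y (cmpt i) j (t + set_val s)).
Proof.
move=> t0; have [B [bX bY]] := bXY.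
have dX := frozen_is_derive trO ix i t0; have dY := frozen_is_derive trO iy i t0.
have iX j u (rho : pastMeasure R) :
    rho.-integrable setT (EFin \o (fun s : past R => X j (u + set_val s))).
  by apply: (@integrable_past _ _ _ B) => [|s] //; exact: continuous_shift_past.
have iY j u (rho : pastMeasure R) :
    rho.-integrable setT (EFin \o (fun s : past R => Y j (u + set_val s))).
  by apply: (@integrable_past _ _ _ B) => [|s] //; exact: continuous_shift_past.
have igz (Z : 'I_m -> R -> R) j :
    (forall j, continuous (Z j)) -> (forall j t, `|Z j t| <= B) ->
    (mu i j).-integrable setT
      (EFin \o (fun s : past R => g (cmpt i) j (t + set_val s) (Z j (t + set_val s)))).
  move=> cZ bZ; have [M _ HM] := rate_bounded (admg (cmpt i) j) (@mong (cmpt i) j) B.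
  apply: (@integrable_past _ _ _ M) => [|s]; last exact: HM.
  apply: (@continuous_shift_past _ (fun u => g (cmpt i) j u (Z j u))).
  exact: (rate_continuous_comp (admg _ _) (@mong _ _)).
have -> : neutral_diff nu X Y i =
    (fun u => X i u - \sum_j \int[nu i j]_s X j (u + set_val s))
    - (fun u => Y i u - \sum_j \int[nu i j]_s Y j (u + set_val s)).
  apply/funext => u; rewrite /neutral_diff fctE.
  have -> : \sum_j \int[nu i j]_s (X j (u + set_val s) - Y j (u + set_val s)) =
    \sum_j \int[nu i j]_s X j (u + set_val s) - \sum_j \int[nu i j]_s Y j (u + set_val s).
    by rewrite -sumrB; apply: eq_bigr => j _; rewrite RintegralB//; [exact: iX|exact: iY].
  transitivity ((X i u - \sum_j \int[nu i j]_s X j (u + set_val s))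
    - (Y i u - \sum_j \int[nu i j]_s Y j (u + set_val s))) => //.
  by ring.
have -> : - (\sum_k gap g X Y k i t)
      + \sum_j \int[mu i j]_s gap g X Y (cmpt i) j (t + set_val s) =
    base_orbit_rhs g inflow mu X i t - base_orbit_rhs g inflow mu Y i t.
  rewrite /base_orbit_rhs.
  have -> : \sum_j \int[mu i j]_s gap g X Y (cmpt i) j (t + set_val s) =
      \sum_j \int[mu i j]_s g (cmpt i) j (t + set_val s) (X j (t + set_val s))
    - \sum_j \int[mu i j]_s g (cmpt i) j (t + set_val s) (Y j (t + set_val s)).
    rewrite -sumrB; apply: eq_bigr => j _; rewrite -RintegralB//; exact: igz.
  by rewrite /gap sumrB; ring.
exact: is_deriveB.
Qed.

Lemma coincide_frozen j : coincide j -> forall t, X j t = Y j t.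
Proof. by move=> xy t; apply: xy; apply: trO; exact: hull_base. Qed.

Lemma coincide_of_bounded_flow i j (Q : R -> R) (C : R) :
  carries_material g i j ->
  (forall t, is_derive t (1 : R) Q `|gap g X Y i j t|) ->
  (forall T, 0 <= T -> - Q (- T) <= C) -> coincide j.
Proof.
move=> carr dQ QC; have [B [bX bY]] := bXY.
have decay := @decay_of_bounded_flow R m g X Y B admg mong
  (fun j t => le_trans (ler_norm _) (bX j t)) (fun j t => le_trans (ler_norm _) (bY j t))
  X0 Y0 (fun e => @frozen_unif_continuous _ _ _ _ _ _ trO px e)
  (fun e => @frozen_unif_continuous _ _ _ _ _ _ trO py e) i j Q C carr dQ QC.
apply: (@component_eq_of_decay _ _ _ x y hrec _ cx cy _ _ (bundle g inflow)).
- exact: closed_closure.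
- by move=> w Ow s; exact: (graph_orbit trO ix s Ow).
- by move=> w Ow s; exact: (graph_orbit trO iy s Ow).
- exact: hull_base.
move=> e e0; have [T HT] := decay e e0.
(* The cap at 1 is needed because [frozen] follows the orbit only up to that time. *)
exists (Num.min T 1) => t; rewrite le_min => /andP[tT t1].
by have := HT t tT; rewrite /X /Y (frozen_orbit trO ix)// (frozen_orbit trO iy).
Qed.

(** Casts [gap_budget] so that, at each fixed [T], the numbers [- Q i j (- T)] are a flow [N]
    obeying the conservation lemmas. *)
Lemma flow_budget : exists Q : 'I_m.+1 -> 'I_m -> R -> R, exists C : R,
  [/\ forall i j t, is_derive t (1 : R) (Q i j) `|gap g X Y i j t|,
      forall i j T, 0 <= T -> 0 <= - Q i j (- T),
      forall i j T, 0 <= T -> (forall t, gap g X Y i j t = 0) -> - Q i j (- T) = 0 &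
      forall i T, 0 <= T ->
        \sum_k - Q k i (- T) <= \sum_j - Q (cmpt i) j (- T) + C].
Proof.
have [B [bX bY]] := bXY.
have [Q [C [Q0 dQ QC]]] := gap_budget admg mong hmu heta cX cY bX bY neutral_diff_is_derive.
exists Q, C; split => // i j T T0.
  rewrite oppr_ge0 -(Q0 i j); apply: (primitive_le _ (dQ i j)); last by rewrite oppr_le0.
  by move=> t; exact: normr_ge0.
move=> gap0; have T0' : - T <= 0 by rewrite oppr_le0.
(* A vanishing mismatch makes [Q i j] Lipschitz with constant [0], hence constant. *)
have lip t : `|(`|gap g X Y i j t|)| <= 0 by rewrite gap0 !normr0.
have := primitive_lipschitz lip (dQ i j) T0'.
by rewrite Q0 mul0r sub0r normrN normr_le0 => /eqP ->; rewrite oppr0.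
Qed.

Lemma gap0_of_coincide i j : coincide j -> forall t, gap g X Y i j t = 0.
Proof. by move=> xy t; rewrite /gap coincide_frozen// subrr. Qed.

(** A pipe carrying no material has zero rate on nonnegative contents, and both frozen orbits are
    nonnegative. *)
Lemma gap0_of_not_carries i j : ~ carries_material g i j -> forall t, gap g X Y i j t = 0.
Proof.
move=> nc t; have [g0|//] := hpipe i j.
by rewrite /gap !g0 ?subrr.
Qed.

Lemma coincide_outflow j : carries_material g ord0 j -> coincide j.
Proof.
have [Q [C [dQ Q0 _ QC]]] := flow_budget.
move=> carr; apply: (coincide_of_bounded_flow carr (dQ ord0 j)) => T T0.
exact: (outflow_le (N := fun i j => - Q i j (- T))
  (fun i j => Q0 i j T T0) (fun i => QC i T T0)).
Qed.

(** Coincidence at [j] cancels every mismatch leaving [j]; [flow_in_le] then bounds all mismatches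
    entering it, in particular the one from [k]. *)
Lemma coincide_upstream j k : carries_material g (cmpt j) k -> coincide j -> coincide k.
Proof.
have [Q [C [dQ Q0 Qz QC]]] := flow_budget.
move=> carr cj.
apply: (coincide_of_bounded_flow (C := m%:R * C - C) carr (dQ (cmpt j) k)) => T T0.
have := flow_in_le (N := fun i j => - Q i j (- T))
  (fun i j => Q0 i j T T0) (fun i => QC i T T0) j.
rewrite [X in _ <= X + _]big1; last by move=> i _; apply: Qz => //; exact: gap0_of_coincide.
rewrite (bigD1 k)//=.
have : 0 <= \sum_(i < m | i != k) - Q (cmpt j) i (- T) by apply: sumr_ge0 => i _; exact: Q0.
lra.
Qed.

Lemma mem_zeta (J : {set 'I_m}) i j :
  j \in J -> carries_material g (cmpt i) j -> i \in zeta g J.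
Proof.
move=> jJ c; apply/finset.bigcupP; exists j => //.
by rewrite finset.inE; apply/asboolP.
Qed.

(** No pipe from the closed set [J] to another compartment carries material, so
    [flow_into_closed_le] bounds the mismatch entering [J] from [k]. *)
Lemma coincide_upstream_closed (J : {set 'I_m}) i k : zeta g J \subset J ->
  i \in J -> k \notin J -> carries_material g (cmpt i) k -> coincide k.
Proof.
have [Q [C [dQ Q0 Qz QC]]] := flow_budget.
move=> closedJ iJ kJ carr; apply: (coincide_of_bounded_flow carr (dQ (cmpt i) k)) => T T0.
apply: (flow_into_closed_le (N := fun i j => - Q i j (- T))
  (fun i j => Q0 i j T T0) (fun i => QC i T T0) _ iJ kJ).
move=> p l pJ lJ; apply: Qz => //; apply: gap0_of_not_carries => c.
by move/negP: lJ; apply; apply: (fintype.subsetP closedJ); exact: mem_zeta c.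
Qed.

Lemma zeta_closed_irreducible (S : {set 'I_m}) : S != finset.set0 -> zeta g S \subset S ->
  exists2 J : {set 'I_m}, irreducible g J & J \subset S.
Proof.
move=> S0 SS.
pose P (A : {set 'I_m}) := (A != finset.set0) && (zeta g A \subset A).
have [|J /minsetP[/andP[J0 JJ] minJ] JS] := @minset_exists _ P S; first by rewrite /P S0.
exists J => //; split => // J' J'0 /andP[J'J nJJ'].
apply/negP => J'J'; move/negP: nJJ'; apply.
by rewrite (minJ J')// /P J'0.
Qed.

Let bad (A : {set 'I_m}) : {set 'I_m} := [set l in A | ~~ `[< coincide l >]]%SET.

Let mem_bad A l : l \in bad A <-> l \in A /\ ~ coincide l.
Proof.
rewrite finset.inE; split=> [/andP[lA /asboolPn]//|[lA ncl]].
by rewrite lA; apply/asboolPn.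
Qed.

(** By [coincide_upstream], a compartment fed from one where coincidence fails must itself fail; the
    hypothesis only has to keep it in [A]. *)
Lemma zeta_bad (A : {set 'I_m}) :
  (forall l p, l \in bad A -> carries_material g (cmpt p) l -> p \in A) ->
  zeta g (bad A) \subset bad A.
Proof.
move=> HA; apply/fintype.subsetP => p /finset.bigcupP[l lb].
rewrite finset.inE => /asboolP carr; apply/mem_bad; split; first exact: HA carr.
by move=> cp; have /mem_bad[_] := lb; apply; exact: coincide_upstream carr cp.
Qed.

(** A pipe from a transient compartment into an irreducible set would force coincidence at its
    source. So the failing transient compartments form a closed set; were it nonempty, it would
    contain an irreducible set, although transient compartments lie in none. *)
Lemma coincide_transient i : i \in transient g -> coincide i.
Proof.
move=> it; apply: contrapT => nci.
have b0 : bad (transient g) != finset.set0.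
  by apply/set0Pn; exists i; apply/mem_bad.
have bz : zeta g (bad (transient g)) \subset bad (transient g).
  apply: zeta_bad => l p /mem_bad[lt ncl] carr.
  rewrite finset.inE; apply/negP => /finset.bigcupP[J /asboolP irrJ pJ].
  apply: ncl; have [_ JJ _] := irrJ; apply: (coincide_upstream_closed JJ pJ _ carr).
  apply/negP => lJ; move: lt; rewrite finset.inE => /negP; apply.
  by apply/finset.bigcupP; exists J => //; apply/asboolP.
have [J irrJ Jb] := zeta_closed_irreducible b0 bz.
have [/set0Pn[l lJ] _ _] := irrJ.
have /mem_bad[+ _] := fintype.subsetP Jb l lJ.
rewrite finset.inE => /negP; apply.
by apply/finset.bigcupP; exists J => //; apply/asboolP.
Qed.

(** The failing part of [J] is closed and misses [j], hence is proper; irreducibility leaves only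
    the empty set. *)
Lemma coincide_irreducible (J : {set 'I_m}) j : irreducible g J -> j \in J ->
  carries_material g ord0 j -> forall i, i \in J -> coincide i.
Proof.
move=> [J0 JJ minJ] jJ carr i iJ; apply: contrapT => nci.
have b0 : bad J != finset.set0 by apply/set0Pn; exists i; apply/mem_bad.
have bJ : bad J \proper J.
  apply/properP; split; first by apply/fintype.subsetP => l /mem_bad[].
  by exists j => //; apply/negP => /mem_bad[_]; apply; exact: coincide_outflow.
move/negP: (minJ _ b0 bJ); apply; apply: zeta_bad => l p /mem_bad[lJ _] c.
by apply: (fintype.subsetP JJ); exact: mem_zeta c.
Qed.
End Comparison.

Theorem theorem6p7 (R : realType) (m : nat)
  (g : 'I_m.+1 -> 'I_m -> R -> R -> R) (inflow : 'I_m -> R -> R)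
  (mu nu : 'I_m -> 'I_m -> pastMeasure R)
  (hg : transport_hyp g inflow)
  (hrec : recurrent (bundle g inflow))
  (hmu : transit_hyp mu)
  (hnu : neutral_hyp nu)
  (heta : eta_hyp mu nu g)
  (hpipe : pipe_hyp g)
  (hF : F_regular mu (hull (bundle g inflow)))
  (hbdd : exists z, bounded_solution mu nu g inflow z)
  (x y : @ratefun R m -> past R -> 'rV[R]_m)
  (hK1 : minimal_subset mu nu (hull (bundle g inflow))
           (graph_over (hull (bundle g inflow)) x))
  (hK2 : minimal_subset mu nu (hull (bundle g inflow))
           (graph_over (hull (bundle g inflow)) y))
  (hx : graph_over (hull (bundle g inflow)) x
          `<=` hull (bundle g inflow) `*` BUDpos nu)
  (hy : graph_over (hull (bundle g inflow)) y
          `<=` hull (bundle g inflow) `*` BUDpos nu) :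
  (forall i : 'I_m, i \in transient g ->
     forall w, hull (bundle g inflow) w -> forall s, x w s 0 i = y w s 0 i) /\
  (forall J : {set 'I_m}, irreducible g J ->
     (exists2 j, j \in J & carries_material g ord0 j) ->
     forall i, i \in J ->
     forall w, hull (bundle g inflow) w -> forall s, x w s 0 i = y w s 0 i).
Proof.
have [admg _ mong _ _] := hg; have [_ nu1] := hnu.
have [_ _ cx ix _] := hK1; have [_ _ cy iy _] := hK2.
split=> [i it|J irrJ [j jJ carr] i iJ].
  exact: (coincide_transient admg mong hrec hmu nu1 heta hpipe cx cy ix iy hx hy it).
exact: (coincide_irreducible admg mong hrec hmu nu1 heta cx cy ix iy hx hy irrJ jJ carr iJ).
Qed.
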